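(* Let $\lambda>0$, $D_g>0$ and $D_i>4D_g$, and set $$D(U)=D_i\left(1-4U+3U^2\right)+D_g\left(4U-3U^2\right),\qquad R(U)=\lambda U(1-U).$$ Then for every wave speed $$c\ge c^*:=2\sqrt{\lambda D_i}$$ the partial differential equation $$\frac{\partial U}{\partial t}=\frac{\partial}{\partial x}\left(D(U)\frac{\partial U}{\partial x}\right)+R(U),\qquad x\in\mathbb{R},\ t>0,$$ has a smooth monotone nonnegative travelling wave solution with speed $c$.
   Context: A travelling wave solution with speed $c>0$ is a solution of the form $U(x,t)=u(z)$, $z=x-ct\in\mathbb{R}$, where the profile $u$ satisfies the second-order ordinary differential equation $$\frac{d}{dz}\left(D(u)\frac{du}{dz}\right)+c\frac{du}{dz}+R(u)=0$$ together with the asymptotic boundary conditions $\lim_{z\to-\infty}u(z)=1$ and $\lim_{z\to\infty}u(z)=0$. It is monotone if $u$ is monotone in $z$, and nonnegative if $u(z)\ge 0$ for all $z$. ''Smooth'' is used in contrast with shock-fronted (discontinuous) travelling waves: the profile $u$ is a classical solution of the ordinary differential equation $\frac{d}{dz}\left(D(u)\frac{du}{dz}\right)+c\frac{du}{dz}+R(u)=0$ on all of $\mathbb{R}$. Under the hypotheses, $D$ changes sign exactly twice on $(0,1)$: $D>0$ on $[0,\alpha)\cup(\beta,1]$ and $D<0$ on $(\alpha,\beta)$, where $$\alpha=\frac{2}{3}-\frac{\sqrt{D_{i}^{2}+4D_{g}^2-5D_{i}D_{g}}}{3(D_i-D_g)},\qquad \beta=\frac{2}{3}+\frac{\sqrt{D_{i}^{2}+4D_{g}^2-5D_{i}D_{g}}}{3(D_i-D_g)},$$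 with $1/3<\alpha<2/3<\beta<1$. *)

(* Defs.v *)
From Stdlib Require Import Reals.
From Coquelicot Require Import Coquelicot.
Open Scope R_scope.

Definition diffusivity (Di Dg U : R) : R :=
  Di * (1 - 4 * U + 3 * U ^ 2) + Dg * (4 * U - 3 * U ^ 2).

Definition reaction (lambda U : R) : R := lambda * U * (1 - U).

(** Coquelicot's [Derive] is total, so every derivative occurring in the
    equations below is also required to exist. *)
Definition solves_pde (D F : R -> R) (U : R -> R -> R) : Prop :=
  forall x t : R, 0 < t ->
    ex_derive (fun s => U x s) t /\
    ex_derive (fun y => U y t) x /\
    ex_derive (fun y => D (U y t) * Derive (fun w => U w t) y) x /\
    Derive (fun s => U x s) t =
      Derive (fun y => D (U y t) * Derive (fun w => U w t) y) x + F (U x t).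

Definition C1 (f : R -> R) : Prop :=
  forall z : R, ex_derive f z /\ continuous (Derive f) z.

(** Classical solutions of (D(u) u')' + c u' + F(u) = 0 on the whole line.  The
    equation is kept in divergence form: the profile and its flux D(u) u' are
    C^1.  Where D(u) vanishes the equation is singular, and no second derivative
    of u is presupposed there. *)
Definition flux (D u : R -> R) (z : R) : R := D (u z) * Derive u z.

Definition classical_ode_solution (D F : R -> R) (c : R) (u : R -> R) : Prop :=
  C1 u /\ C1 (flux D u) /\
  forall z : R, Derive (flux D u) z + c * Derive u z + F (u z) = 0.

Definition smooth_travelling_wave (D F : R -> R) (c : R) (u : R -> R) : Prop :=
  0 < c /\
  solves_pde D F (fun x t => u (x - c * t)) /\
  classical_ode_solution D F c u /\
  is_lim u m_infty 1 /\
  is_lim u p_infty 0.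

Definition monotone (u : R -> R) : Prop :=
  (forall y z : R, y <= z -> u y <= u z) \/
  (forall y z : R, y <= z -> u z <= u y).

Definition nonnegative (u : R -> R) : Prop := forall z : R, 0 <= u z.

(* Main.v *)
Require Import Defs.
From Stdlib Require Import Reals Lra Lia.
From Coquelicot Require Import Coquelicot.
Open Scope R_scope.

(** Look for a decreasing wave and describe it by its decay rate [w = - u'] as a
    function of [u].  With [p = D * w] the equation becomes [p' = c - R / w], or
    [p * p' = c * p - D * R], on (0,1).  Between consecutive zeros of [D * R] this is
    the phase plane of a Fisher-KPP wave: on (0,al) and (be,1) for the reaction
    [D * R], on (al,be) for [- D * R], with [p] negative.  In each of the three segments
    one end is a saddle ([al], [al] and [1]) and the other a node ([0], [be] and [be]),
    and the invariant manifold of the saddle has to be followed to the node.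

    Normalise a segment to [0,1] with the saddle at [0], write [Rabs p] as its length
    times [x * (1 - x) * P x], and [Rabs (D * R)] as its length times
    [x * (1 - x) * G x].  The equation is [(x * (1 - x) * P)' = - c + G / P].  It is
    solved between a small constant and the constant [c / 2], which is an upper
    solution when [G <= (c / 2) ^ 2].  Adding a large multiple of [P] on both sides
    makes the problem a fixed point equation for a map that is monotone and contracts
    a weighted uniform norm ([orbit_map_band], [orbit_map_contraction]); its fixed
    point is continuous up to the saddle.  A Gronwall argument shows that it
    has the slow slope at the node ([node_limit]).  On the first segment [G] equals
    [lambda * Di * (1 - u / be) * (1 - u)], which is at most [lambda * Di]; on the
    other two it stays below [lambda * Di].  So [c >= 2 * sqrt (lambda * Di)] suffices.

    At [al] two orbits leave saddles with the same characteristic equation, at [be] two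
    orbits enter nodes along the slow direction.  Hence [w] is continuous
    and positive across both zeros of [D], and as [p = D * w] there, [p] is C^1
    ([heteroclinic_orbit]).  It remains to solve [u' = - w u].  As [w] is
    [u * (1 - u)] times a positive, continuous and bounded function, this is a
    separable equation with global solutions in the coordinate [ln ((1 - u) / u)], and
    the solution runs from [1] to [0] ([autonomous_solution], [wave_of_orbit]). *)

(** * Continuity *)

Lemma differentiable_continuous (f : R -> R) (x : R) :
  ex_derive f x -> continuous f x.
Proof. exact (ex_derive_continuous (K := R_AbsRing) (V := R_NormedModule) f x). Qed.

Lemma continuous_of_approx (f : R -> R) (x : R) :
  (forall eps, 0 < eps -> exists g : R -> R, continuous g x /\
     exists d, 0 < d /\ forall y, Rabs (y - x) < d -> Rabs (f y - g y) <= eps) ->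
  continuous f x.
Proof.
  intros H. apply continuity_pt_filterlim. intros eps Heps.
  destruct (H (eps / 4)) as (g & Hg & d & Hd & Hfg); [lra|].
  apply continuity_pt_filterlim in Hg.
  destruct (Hg (eps / 4)) as (d' & Hd' & Hgg); [lra|].
  exists (Rmin d d'). split; [now apply Rmin_pos|].
  intros y [Hy1 Hy2]. simpl in *. unfold R_dist in *.
  assert (H1 : Rabs (y - x) < d) by (eapply Rlt_le_trans; [exact Hy2|apply Rmin_l]).
  assert (H2 : Rabs (y - x) < d') by (eapply Rlt_le_trans; [exact Hy2|apply Rmin_r]).
  assert (H3 := Hfg y H1).
  assert (H4 : Rabs (f x - g x) <= eps / 4).
  { apply Hfg. rewrite Rminus_eq_0, Rabs_R0; lra. }
  assert (H5 : Rabs (g y - g x) < eps / 4) by (apply Hgg; split; assumption).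
  apply Rabs_le_between in H3. apply Rabs_le_between in H4.
  apply Rabs_lt_between in H5. apply Rabs_lt_between. lra.
Qed.

Lemma continuity_2d_pt_section (F : R -> R -> R) (v s : R) :
  continuity_2d_pt F v s -> continuous (F v) s.
Proof.
  intros HF. apply continuity_pt_filterlim. intros eps Heps.
  destruct (HF (mkposreal eps Heps)) as [d Hd].
  exists d. split; [apply cond_pos|]. intros y [_ Hy].
  apply Hd; [rewrite Rminus_eq_0, Rabs_R0; apply cond_pos | exact Hy].
Qed.

Lemma continuous_RInt_param (F : R -> R -> R) (v : R) :
  (forall w s, 0 <= s <= 1 -> continuity_2d_pt F w s) ->
  continuous (fun w => RInt (F w) 0 1) v.
Proof.
  intros HF.
  assert (Hint : forall w, ex_RInt (F w) 0 1).
  { intros w. apply (ex_RInt_continuous (V := R_CompleteNormedModule)).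
    intros s Hs. rewrite Rmin_left, Rmax_right in Hs by lra.
    apply continuity_2d_pt_section; auto. }
  apply continuity_pt_filterlim. intros eps Heps.
  assert (Heps2 : 0 < eps / 2) by lra.
  destruct (uniform_continuity_2d_1d (fun s w => F w s) 0 1 v) with
    (eps := mkposreal _ Heps2) as [d Hd].
  { intros s Hs e. destruct (HF v s Hs e) as [d Hd]. exists d.
    intros a b Ha Hb. now apply Hd. }
  exists d. split; [apply cond_pos|]. intros w [_ Hw].
  unfold R_dist, dist in *; simpl in *. unfold R_dist in *.
  replace (RInt (F w) 0 1 - RInt (F v) 0 1)
    with (RInt (fun s => F w s - F v s) 0 1)
    by (apply (RInt_minus (V := R_CompleteNormedModule)); auto).
  apply Rle_lt_trans with ((1 - 0) * (eps / 2)); [|lra].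
  apply abs_RInt_le_const; [lra| | ].
  { apply (ex_RInt_minus (V := R_NormedModule)); auto. }
  intros s Hs. left. pose proof (cond_pos d).
  apply (Hd s v s w); try lra; rewrite ?Rminus_eq_0, ?Rabs_R0; try lra.
  apply Rabs_lt_between in Hw; lra.
Qed.

Lemma continuity_2d_pt_pow (f : R -> R -> R) (n : nat) x y :
  continuity_2d_pt f x y -> continuity_2d_pt (fun u v => f u v ^ n) x y.
Proof.
  intros Hf. induction n as [|n IH]; simpl.
  - apply continuity_2d_pt_const.
  - now apply continuity_2d_pt_mult.
Qed.

(** * The integral operator of a saddle-node orbit *)

(** With [k = n + 2], adding [k * P] to both sides of the orbit equation leaves
    [relaxed_rhs] on the right; for [k] large it is increasing in [P] on the band
    [kap <= P <= M]. *)
Definition relaxed_rhs (c : R) (n : nat) (Gam P : R -> R) (v : R) : R :=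
  - c + Gam v / P v + INR (n + 2) * P v.

Definition kernel (n : nat) (v s : R) : R :=
  s ^ (n + 2) * ((1 + Rabs v) / (1 + Rabs v * s)) ^ 2.

(** The solution, bounded at [v = 0], of the linear equation obtained when [relaxed_rhs]
    is evaluated at a given [P].  Writing the integral over [0, v] as an average over
    [s] in [0, 1] makes it regular at the saddle [v = 0].  Only [v >= 0] is
    meaningful; taking [Rabs v] gives functions that are continuous on all of [R]. *)
Definition orbit_map (c : R) (n : nat) (Gam P : R -> R) (v : R) : R :=
  RInt (fun s => kernel n v s * relaxed_rhs c n Gam P (Rabs v * s)) 0 1.

Lemma relaxed_rhs_continuous c n Gam P v :
  continuous Gam v -> continuous P v -> P v <> 0 ->
  continuous (relaxed_rhs c n Gam P) v.
Proof.
  intros HG HP H0. unfold relaxed_rhs.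
  apply (continuous_plus (V := R_NormedModule)).
  - apply (continuous_plus (V := R_NormedModule)); [apply continuous_const|].
    apply (continuous_mult (K := R_AbsRing)); [assumption|].
    now apply continuous_Rinv_comp.
  - apply (continuous_mult (K := R_AbsRing)); [apply continuous_const|assumption].
Qed.

Lemma orbit_integrand_continuity c n Gam P :
  (forall v, continuous Gam v) -> (forall v, continuous P v) ->
  (forall v, 0 < P v) -> forall v s, 0 <= s ->
  continuity_2d_pt (fun v s => kernel n v s * relaxed_rhs c n Gam P (Rabs v * s)) v s.
Proof.
  intros HG HP H0 v s Hs.
  assert (Ha : continuity_2d_pt (fun v s => Rabs v) v s).
  { apply (continuity_1d_2d_pt_comp Rabs (fun u _ => u)).
    - apply Rcontinuity_abs.
    - apply continuity_2d_pt_id1. }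
  assert (Has : continuity_2d_pt (fun v s => Rabs v * s) v s).
  { apply continuity_2d_pt_mult; [exact Ha | apply continuity_2d_pt_id2]. }
  pose proof (Rabs_pos v).
  unfold kernel.
  apply continuity_2d_pt_mult; [apply continuity_2d_pt_mult|].
  - apply continuity_2d_pt_pow, continuity_2d_pt_id2.
  - apply (continuity_2d_pt_pow (fun v s => (1 + Rabs v) / (1 + Rabs v * s))).
    apply continuity_2d_pt_mult;
      [| apply (continuity_2d_pt_inv (fun v s => 1 + Rabs v * s)); [|nra]];
      apply continuity_2d_pt_plus; auto using continuity_2d_pt_const.
  - apply (continuity_1d_2d_pt_comp (relaxed_rhs c n Gam P) (fun v s => Rabs v * s)).
    + apply continuity_pt_filterlim, relaxed_rhs_continuous; auto.
      specialize (H0 (Rabs v * s)); lra.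
    + exact Has.
Qed.

Lemma orbit_integrand_ex_RInt c n Gam P v :
  (forall v, continuous Gam v) -> (forall v, continuous P v) ->
  (forall v, 0 < P v) ->
  ex_RInt (fun s => kernel n v s * relaxed_rhs c n Gam P (Rabs v * s)) 0 1.
Proof.
  intros HG HP H0.
  apply (ex_RInt_continuous (V := R_CompleteNormedModule)).
  intros s Hs. rewrite Rmin_left, Rmax_right in Hs by lra.
  apply (continuity_2d_pt_section
    (fun v s => kernel n v s * relaxed_rhs c n Gam P (Rabs v * s))).
  apply orbit_integrand_continuity; auto; lra.
Qed.

Lemma orbit_map_continuous c n Gam P v :
  (forall v, continuous Gam v) -> (forall v, continuous P v) ->
  (forall v, 0 < P v) -> continuous (orbit_map c n Gam P) v.
Proof.
  intros HG HP H0. unfold orbit_map.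
  apply continuous_RInt_param. intros w s Hs.
  apply orbit_integrand_continuity; auto; lra.
Qed.

Lemma kernel_ratio_bounds v s : 0 < s <= 1 ->
  1 <= (1 + Rabs v) / (1 + Rabs v * s) <= / s.
Proof.
  intros Hs. pose proof (Rabs_pos v).
  assert (0 < 1 + Rabs v * s) by nra.
  split.
  - apply Rmult_le_reg_r with (1 + Rabs v * s); [lra|].
    replace ((1 + Rabs v) / (1 + Rabs v * s) * (1 + Rabs v * s)) with (1 + Rabs v)
      by (field; lra). nra.
  - apply Rmult_le_reg_r with (s * (1 + Rabs v * s)); [nra|].
    replace ((1 + Rabs v) / (1 + Rabs v * s) * (s * (1 + Rabs v * s)))
      with (s * (1 + Rabs v)) by (field; lra).
    replace (/ s * (s * (1 + Rabs v * s))) with (1 + Rabs v * s) by (field; lra).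
    nra.
Qed.

Lemma kernel_lower n v s : 0 < s <= 1 -> s ^ (n + 2) <= kernel n v s.
Proof.
  intros Hs. unfold kernel. destruct (kernel_ratio_bounds v s Hs) as [H1 _].
  assert (0 < s ^ (n + 2)) by (apply pow_lt; lra).
  set (r := (1 + Rabs v) / _) in *.
  assert (1 <= r ^ 2) by nra. nra.
Qed.

Lemma kernel_upper n v s : 0 < s <= 1 -> kernel n v s <= s ^ n.
Proof.
  intros Hs. unfold kernel. destruct (kernel_ratio_bounds v s Hs) as [H1 H2].
  assert (0 < s ^ n) by (apply pow_lt; lra).
  set (r := (1 + Rabs v) / _) in *.
  rewrite pow_add.
  assert (s * r <= 1).
  { apply Rmult_le_compat_l with (r := s) in H2; [|lra].
    rewrite Rinv_r in H2; lra. }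
  replace (s ^ n * s ^ 2 * r ^ 2) with (s ^ n * (s * r) ^ 2) by ring.
  assert (0 <= s * r) by nra.
  assert ((s * r) ^ 2 <= 1) by nra. nra.
Qed.

(** Bounding only one of the two factors [(1 + v) / (1 + v s)] by [/ s] keeps the
    growth [1 + v] of the norm used for the contraction and gains one power of [s]. *)
Lemma kernel_upper_weighted n v s : 0 < s <= 1 ->
  kernel n v s * (1 + Rabs v * s) <= s ^ (n + 1) * (1 + Rabs v).
Proof.
  intros Hs. unfold kernel. destruct (kernel_ratio_bounds v s Hs) as [H1 H2].
  pose proof (Rabs_pos v).
  assert (0 < 1 + Rabs v * s) by nra.
  assert (0 < s ^ n) by (apply pow_lt; lra).
  replace (s ^ (n + 2) * ((1 + Rabs v) / (1 + Rabs v * s)) ^ 2 * (1 + Rabs v * s))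
    with (s ^ (n + 1) * (1 + Rabs v) * (s * ((1 + Rabs v) / (1 + Rabs v * s))))
    by (rewrite !pow_add; field; lra).
  set (r := (1 + Rabs v) / _) in *.
  assert (s * r <= 1).
  { apply Rmult_le_compat_l with (r := s) in H2; [|lra].
    rewrite Rinv_r in H2; lra. }
  assert (0 <= s ^ (n + 1) * (1 + Rabs v)).
  { apply Rmult_le_pos; [|lra]. left; apply pow_lt; lra. }
  nra.
Qed.

Lemma is_RInt_pow01 (n : nat) (a : R) :
  is_RInt (fun s => a * s ^ n) 0 1 (a / INR (S n)).
Proof.
  replace (a / INR (S n)) with (a * (1 ^ S n / INR (S n) - 0 ^ S n / INR (S n)))
    by (rewrite pow1, pow_i by lia; field; apply not_0_INR; lia).
  exact (is_RInt_scal (V := R_NormedModule) _ _ _ a _ (is_RInt_pow 0 1 n)).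
Qed.

Definition in_band (kap M : R) (P : R -> R) : Prop :=
  (forall v, continuous P v) /\ (forall v, kap <= P v <= M).

(** The constants [kap] and [M] are a lower and an upper solution, and [orbit_map] is
    monotone on the band.  For the upper one, with [c = 2 * M] and
    [k = n + 2], [Gam <= M ^ 2] bounds [relaxed_rhs] by [(k - 1) * M], while the kernel
    is at most [s ^ (k - 2)], of mass [1 / (k - 1)]: this is where the minimal speed
    enters. *)
Lemma orbit_map_band (M kap g : R) (n : nat) (Gam P : R -> R) :
  0 < kap <= M -> 3 * M * kap <= g -> M ^ 2 <= INR (n + 2) * kap ^ 2 ->
  (forall v, continuous Gam v) -> (forall v, g <= Gam v <= M ^ 2) ->
  in_band kap M P -> in_band kap M (orbit_map (2 * M) n Gam P).
Proof.
  intros Hk Hg Hn HG HGb [HP HPb].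
  assert (HP0 : forall v, 0 < P v) by (intros v; specialize (HPb v); lra).
  split; [intros v; apply orbit_map_continuous; auto|].
  assert (Hmon : forall v, (INR (n + 2) + 1) * kap <= relaxed_rhs (2 * M) n Gam P v
             <= (INR (n + 2) - 1) * M).
  { intros v. unfold relaxed_rhs. specialize (HPb v). specialize (HP0 v). specialize (HGb v).
    set (k := INR (n + 2)) in *. set (p := P v) in *. set (G := Gam v) in *.
    assert (Hk0 : 0 < kap ^ 2) by nra.
    assert (Hk1 : 1 <= k).
    { apply Rmult_le_reg_r with (kap ^ 2); [lra|]. nra. }
    assert (Hmul : forall a, 0 < a -> forall x y, x * a <= y * a -> x <= y).
    { intros a Ha x y. now apply Rmult_le_reg_r. }
    split.
    - apply (Hmul p HP0).
      replace ((- (2 * M) + G / p + k * p) * p) with (- (2 * M) * p + G + k * p ^ 2)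
        by (field; lra).
      (* [k * kap >= 3 * M], so [k * p - 2 * M - kap >= 0]; apart from
         the product below, what remains is [2 * M * kap + kap ^ 2 <= G]. *)
      assert (G <= k * kap ^ 2) by lra.
      assert (k * kap * kap >= G) by nra.
      assert (0 <= (p - kap) * (k * p - 2 * M - kap)).
      { apply Rmult_le_pos; [lra|].
        assert (k * kap >= 3 * M).
        { apply Rle_ge, (Hmul kap); nra. }
        nra. }
      nra.
    - apply (Hmul p HP0).
      replace ((- (2 * M) + G / p + k * p) * p) with (- (2 * M) * p + G + k * p ^ 2)
        by (field; lra).
      (* Since [G <= M ^ 2], the difference of the two sides is at most
         [(M - p) * (M - k * p)]. *)
      assert (M <= k * p).
      { apply (Hmul kap); [lra|]. nra. }
      assert ((M - p) * (M - k * p) <= 0) by nra.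
      nra. }
  intros v. unfold orbit_map.
  assert (Hk0 : 0 < kap ^ 2) by nra.
  assert (Hk1 : 1 <= INR (n + 2)).
  { apply Rmult_le_reg_r with (kap ^ 2); [lra|]. nra. }
  assert (Hi := orbit_integrand_ex_RInt (2 * M) n Gam P v HG HP HP0).
  split.
  - assert (Hp := is_RInt_pow01 (n + 2) ((INR (n + 2) + 1) * kap)).
    rewrite S_INR in Hp.
    replace ((INR (n + 2) + 1) * kap / (INR (n + 2) + 1)) with kap in Hp by (field; lra).
    rewrite <- (is_RInt_unique _ _ _ _ Hp).
    apply RInt_le; [lra|eexists; exact Hp|exact Hi|].
    intros s Hs. assert (Hs' : 0 < s <= 1) by lra.
    pose proof (kernel_lower n v s Hs'). destruct (Hmon (Rabs v * s)) as [Hm _].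
    assert (0 < s ^ (n + 2)) by (apply pow_lt; lra).
    apply Rle_trans with ((INR (n + 2) + 1) * kap * kernel n v s); [|nra].
    apply Rmult_le_compat_l; [nra|lra].
  - assert (Hp := is_RInt_pow01 n ((INR (n + 2) - 1) * M)).
    rewrite S_INR in Hp.
    replace (INR n + 1) with (INR (n + 2) - 1) in Hp
      by (rewrite plus_INR; simpl; lra).
    assert (Hk2 : 2 <= INR (n + 2)).
    { rewrite plus_INR. pose proof (pos_INR n). simpl; lra. }
    replace ((INR (n + 2) - 1) * M / (INR (n + 2) - 1)) with M in Hp by (field; lra).
    refine (Rle_trans _ _ _ _ (Req_le _ _ (is_RInt_unique _ _ _ _ Hp))).
    apply RInt_le; [lra|exact Hi|eexists; exact Hp|].
    intros s Hs. assert (Hs' : 0 < s <= 1) by lra.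
    pose proof (kernel_upper n v s Hs'). destruct (Hmon (Rabs v * s)) as [_ Hm].
    pose proof (kernel_lower n v s Hs').
    assert (0 < s ^ (n + 2)) by (apply pow_lt; lra).
    apply Rle_trans with ((INR (n + 2) - 1) * M * kernel n v s); [nra|].
    apply Rmult_le_compat_l; [nra|lra].
Qed.

(** The slope of [relaxed_rhs] in [P] is [k - Gam / (P1 * P2)], between [0] and
    [k - g / M ^ 2], and the weight [1 + v] makes the kernel have mass at most [1 / k].
    Without the weight the map need not contract near the node, where [v] is
    infinite. *)
Lemma orbit_map_contraction (M kap g d : R) (n : nat) (Gam P1 P2 : R -> R) :
  0 < kap <= M -> 0 < g -> M ^ 2 <= INR (n + 2) * kap ^ 2 ->
  (forall v, continuous Gam v) -> (forall v, g <= Gam v <= M ^ 2) ->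
  in_band kap M P1 -> in_band kap M P2 ->
  (forall v, Rabs (P1 v - P2 v) <= d * (1 + Rabs v)) ->
  forall v, Rabs (orbit_map (2 * M) n Gam P1 v - orbit_map (2 * M) n Gam P2 v)
    <= (1 - g / M ^ 2 / INR (n + 2)) * d * (1 + Rabs v).
Proof.
  intros Hk Hg0 Hn HG HGb [HP1 HB1] [HP2 HB2] Hd v.
  assert (HP10 : forall v, 0 < P1 v) by (intros w; specialize (HB1 w); lra).
  assert (HP20 : forall v, 0 < P2 v) by (intros w; specialize (HB2 w); lra).
  assert (Hi1 := orbit_integrand_ex_RInt (2 * M) n Gam P1 v HG HP1 HP10).
  assert (Hi2 := orbit_integrand_ex_RInt (2 * M) n Gam P2 v HG HP2 HP20).
  unfold orbit_map.
  assert (Hi := ex_RInt_minus (V := R_NormedModule) _ _ _ _ Hi1 Hi2).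
  pose proof (RInt_minus (V := R_CompleteNormedModule) _ _ _ _ Hi1 Hi2) as Hsub.
  unfold minus at 2, plus, opp in Hsub; simpl in Hsub.
  unfold Rminus at 1; rewrite <- Hsub; clear Hsub.
  assert (HM2 : 0 < M ^ 2) by nra.
  assert (Hk2 : 2 <= INR (n + 2)).
  { rewrite plus_INR. pose proof (pos_INR n). simpl; lra. }
  set (b := g / M ^ 2).
  assert (Hb : 0 < b) by (apply Rdiv_lt_0_compat; lra).
  assert (Hphi : forall w,
     Rabs (relaxed_rhs (2 * M) n Gam P1 w - relaxed_rhs (2 * M) n Gam P2 w)
     <= (INR (n + 2) - b) * d * (1 + Rabs w)).
  { intros w. specialize (HB1 w). specialize (HB2 w). specialize (HGb w).
    specialize (HP10 w). specialize (HP20 w).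
    unfold relaxed_rhs. set (p1 := P1 w) in *. set (p2 := P2 w) in *. set (G := Gam w) in *.
    replace (- (2 * M) + G / p1 + INR (n + 2) * p1 -
             (- (2 * M) + G / p2 + INR (n + 2) * p2))
      with ((INR (n + 2) - G / (p1 * p2)) * (p1 - p2)) by (field; lra).
    assert (kap ^ 2 <= p1 * p2) by (simpl; rewrite Rmult_1_r; apply Rmult_le_compat; lra).
    assert (p1 * p2 <= M ^ 2) by (simpl; rewrite Rmult_1_r; apply Rmult_le_compat; lra).
    assert (Hpp : 0 < p1 * p2) by nra.
    assert (b <= G / (p1 * p2)).
    { unfold b. unfold Rdiv.
      apply Rmult_le_compat; [lra| | lra | apply Rinv_le_contravar; lra].
      left; apply Rinv_0_lt_compat; lra. }
    assert (G / (p1 * p2) <= INR (n + 2)).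
    { apply Rmult_le_reg_r with (p1 * p2); [lra|].
      replace (G / (p1 * p2) * (p1 * p2)) with G by (field; lra). nra. }
    rewrite Rabs_mult, Rabs_pos_eq by lra.
    rewrite Rmult_assoc.
    apply Rmult_le_compat; [lra|apply Rabs_pos|lra|apply Hd]. }
  assert (Hbk : b <= INR (n + 2)).
  { specialize (HGb 0). unfold b.
    apply Rle_trans with 1; [|lra].
    apply Rmult_le_reg_r with (M ^ 2); [lra|].
    replace (g / M ^ 2 * M ^ 2) with g by (field; lra). lra. }
  assert (Hd0 : 0 <= d).
  { specialize (Hd 0). rewrite Rabs_R0 in Hd. pose proof (Rabs_pos (P1 0 - P2 0)). lra. }
  assert (Hp := is_RInt_pow01 (n + 1) ((INR (n + 2) - b) * d * (1 + Rabs v))).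
  replace (S (n + 1)) with (n + 2)%nat in Hp by lia.
  replace ((1 - b / INR (n + 2)) * d * (1 + Rabs v))
    with ((INR (n + 2) - b) * d * (1 + Rabs v) / INR (n + 2)) by (field; lra).
  rewrite <- (is_RInt_unique _ _ _ _ Hp).
  eapply Rle_trans; [apply abs_RInt_le; [lra|exact Hi]|].
  apply RInt_le; [lra|exact (ex_RInt_norm _ _ _ Hi)|eexists; exact Hp|].
  intros s Hs. assert (Hs' : 0 < s <= 1) by lra.
  unfold minus, plus, opp; simpl.
  replace (kernel n v s * relaxed_rhs (2 * M) n Gam P1 (Rabs v * s) +
     - (kernel n v s * relaxed_rhs (2 * M) n Gam P2 (Rabs v * s)))
    with (kernel n v s * (relaxed_rhs (2 * M) n Gam P1 (Rabs v * s) -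
        relaxed_rhs (2 * M) n Gam P2 (Rabs v * s)))
    by ring.
  pose proof (kernel_lower n v s Hs').
  assert (0 < s ^ (n + 2)) by (apply pow_lt; lra).
  rewrite Rabs_mult, Rabs_pos_eq by lra.
  specialize (Hphi (Rabs v * s)).
  rewrite (Rabs_pos_eq (Rabs v * s)) in Hphi
    by (apply Rmult_le_pos; [apply Rabs_pos|lra]).
  apply Rle_trans with ((INR (n + 2) - b) * d * (kernel n v s * (1 + Rabs v * s))).
  - replace ((INR (n + 2) - b) * d * (kernel n v s * (1 + Rabs v * s)))
      with (kernel n v s * ((INR (n + 2) - b) * d * (1 + Rabs v * s))) by ring.
    apply Rmult_le_compat_l; lra.
  - pose proof (kernel_upper_weighted n v s Hs').
    replace ((INR (n + 2) - b) * d * (1 + Rabs v) * s ^ (n + 1))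
      with ((INR (n + 2) - b) * d * (s ^ (n + 1) * (1 + Rabs v))) by ring.
    apply Rmult_le_compat_l; [apply Rmult_le_pos; lra|lra].
Qed.

(** * The fixed point and its differential equation *)

Lemma geometric_small (th C eps : R) : 0 <= th < 1 -> 0 < eps ->
  exists N : nat, forall n, (N <= n)%nat -> C * th ^ n < eps.
Proof.
  intros Hth Heps.
  assert (HC : 0 < Rabs C + 1) by (pose proof (Rabs_pos C); lra).
  destruct (pow_lt_1_zero th) with (y := eps / (Rabs C + 1)) as [N HN].
  - rewrite Rabs_pos_eq; lra.
  - apply Rdiv_lt_0_compat; lra.
  - exists N. intros n Hn. specialize (HN n Hn).
    rewrite Rabs_pos_eq in HN by (apply pow_le; lra).
    apply Rmult_lt_compat_l with (r := Rabs C + 1) in HN; [|lra].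
    replace ((Rabs C + 1) * (eps / (Rabs C + 1))) with eps in HN by (field; lra).
    pose proof (Rle_abs C). assert (0 <= th ^ n) by (apply pow_le; lra). nra.
Qed.

Lemma le_of_geometric (x C th : R) : 0 <= th < 1 ->
  (forall n, x <= C * th ^ n) -> x <= 0.
Proof.
  intros Hth H. destruct (Rle_lt_dec x 0) as [|Hx]; [assumption|exfalso].
  destruct (geometric_small th C x Hth Hx) as [N HN].
  specialize (HN N (Nat.le_refl _)). specialize (H N). lra.
Qed.

(** Banach's fixed point argument, started from the upper solution.  The
    weighted convergence is uniform on bounded sets, so the limit is continuous, at
    the saddle included. *)
Lemma orbit_fixed_point_exists (M kap g : R) (n : nat) (Gam : R -> R) :
  0 < kap <= M -> 0 < g -> 3 * M * kap <= g -> M ^ 2 <= INR (n + 2) * kap ^ 2 ->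
  (forall v, continuous Gam v) -> (forall v, g <= Gam v <= M ^ 2) ->
  exists P, in_band kap M P /\ forall v, P v = orbit_map (2 * M) n Gam P v.
Proof.
  intros Hk Hg0 Hg Hn HG HGb.
  set (th := 1 - g / M ^ 2 / INR (n + 2)).
  assert (HM2 : 0 < M ^ 2) by nra.
  assert (Hk2 : 2 <= INR (n + 2)).
  { rewrite plus_INR. pose proof (pos_INR n). simpl; lra. }
  assert (Hth : 0 <= th < 1).
  { assert (0 < g / M ^ 2 / INR (n + 2)).
    { apply Rdiv_lt_0_compat; [apply Rdiv_lt_0_compat; lra|lra]. }
    assert (g / M ^ 2 / INR (n + 2) <= 1); [|unfold th; lra].
    apply Rmult_le_reg_r with (M ^ 2 * INR (n + 2)); [nra|].
    replace (g / M ^ 2 / INR (n + 2) * (M ^ 2 * INR (n + 2))) with g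
      by (field; split; nra).
    specialize (HGb 0). nra. }
  set (p := fun m => Nat.iter m (orbit_map (2 * M) n Gam) (fun _ => M)).
  assert (Hadm : forall m, in_band kap M (p m)).
  { induction m as [|m IH].
    - split; intros v; [apply continuous_const|simpl; lra].
    - apply orbit_map_band with g; auto. }
  assert (Hstep : forall m v, Rabs (p (S m) v - p m v) <= M * th ^ m * (1 + Rabs v)).
  { induction m as [|m IH]; intros v.
    - destruct (Hadm 1%nat) as [_ H1]. specialize (H1 v).
      change (p 0%nat v) with M.
      pose proof (Rabs_pos v). apply Rabs_le_between. simpl pow. nra.
    - replace (M * th ^ S m * (1 + Rabs v))
        with (th * (M * th ^ m) * (1 + Rabs v)) by (simpl; ring).
      apply (orbit_map_contraction M kap g (M * th ^ m) n Gam (p (S m)) (p m)); auto. }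
  set (C := M / (1 - th)).
  assert (HC : M = C * (1 - th)) by (unfold C; field; lra).
  assert (HC0 : 0 < C) by (apply Rdiv_lt_0_compat; lra).
  assert (Htail : forall m j v,
    Rabs (p (j + m)%nat v - p m v) <= C * (th ^ m - th ^ (j + m)) * (1 + Rabs v)).
  { intros m j v. induction j as [|j IH].
    - simpl. rewrite Rminus_eq_0, Rabs_R0, Rminus_eq_0. lra.
    - replace (p (S j + m)%nat v - p m v)
        with ((p (S (j + m)) v - p (j + m)%nat v) + (p (j + m)%nat v - p m v))
        by (simpl; ring).
      eapply Rle_trans; [apply Rabs_triang|].
      specialize (Hstep (j + m)%nat v).
      replace (C * (th ^ m - th ^ (S j + m)) * (1 + Rabs v))
        with (C * (1 - th) * th ^ (j + m) * (1 + Rabs v)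
              + C * (th ^ m - th ^ (j + m)) * (1 + Rabs v)) by (simpl; ring).
      rewrite <- HC. lra. }
  assert (Htail' : forall m j v, (m <= j)%nat ->
    Rabs (p j v - p m v) <= C * (1 + Rabs v) * th ^ m).
  { intros m j v Hmj. replace j with ((j - m) + m)%nat by lia.
    eapply Rle_trans; [apply Htail|].
    assert (0 <= th ^ ((j - m) + m)) by (apply pow_le; lra).
    pose proof (Rabs_pos v).
    assert (0 <= C * (1 + Rabs v)) by nra. nra. }
  set (P := fun v => real (Lim_seq (fun m => p m v))).
  assert (Hlim : forall v, is_lim_seq (fun m => p m v) (P v)).
  { intros v. apply Lim_seq_correct', ex_lim_seq_cauchy_corr.
    intros eps.
    destruct (geometric_small th (C * (1 + Rabs v)) (eps / 2) Hth) as [N HN];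
      [pose proof (cond_pos eps); lra|].
    exists N. intros a b Ha Hb.
    replace (p a v - p b v) with ((p a v - p N v) - (p b v - p N v)) by ring.
    eapply Rle_lt_trans; [apply Rabs_triang|]. rewrite Rabs_Ropp.
    pose proof (Htail' N a v Ha). pose proof (Htail' N b v Hb).
    specialize (HN N (Nat.le_refl _)). lra. }
  assert (Hclose : forall m v, Rabs (P v - p m v) <= C * (1 + Rabs v) * th ^ m).
  { intros m v.
    assert (Hl : is_lim_seq (fun j => Rabs (p (j + m)%nat v - p m v))
      (Rabs (P v - p m v))).
    { apply (is_lim_seq_abs _ (P v - p m v)).
      apply (is_lim_seq_minus' (fun j => p (j + m)%nat v) (fun _ => p m v)).
      - apply (is_lim_seq_incr_n (fun j => p j v) m), Hlim.
      - apply is_lim_seq_const. }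
    exact (is_lim_seq_le _ (fun _ => C * (1 + Rabs v) * th ^ m) _ _
      (fun j => Htail' m (j + m)%nat v ltac:(lia)) Hl (is_lim_seq_const _)). }
  assert (HP : in_band kap M P).
  { split; intros v.
    - apply continuous_of_approx. intros eps Heps.
      destruct (geometric_small th (C * (2 + Rabs v)) eps Hth Heps) as [N HN].
      exists (p N). split; [apply (Hadm N)|].
      exists 1. split; [lra|]. intros y Hy.
      eapply Rle_trans; [apply Hclose|].
      specialize (HN N (Nat.le_refl _)).
      assert (Rabs y <= 1 + Rabs v).
      { replace y with ((y - v) + v) by ring.
        eapply Rle_trans; [apply Rabs_triang|]. lra. }
      assert (0 <= th ^ N) by (apply pow_le; lra).
      assert (0 <= C * th ^ N) by (apply Rmult_le_pos; lra). nra.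
    - split.
      + exact (is_lim_seq_le (fun _ => kap) _ _ _
          (fun m => proj1 (proj2 (Hadm m) v)) (is_lim_seq_const _) (Hlim v)).
      + exact (is_lim_seq_le _ (fun _ => M) _ _
          (fun m => proj2 (proj2 (Hadm m) v)) (Hlim v) (is_lim_seq_const _)). }
  exists P. split; [exact HP|]. intros v.
  enough (Rabs (P v - orbit_map (2 * M) n Gam P v) <= 0).
  { destruct (Req_dec (P v - orbit_map (2 * M) n Gam P v) 0) as [|Hne]; [lra|].
    apply Rabs_pos_lt in Hne. lra. }
  apply le_of_geometric with (C := 2 * C * (1 + Rabs v)) (th := th); [exact Hth|].
  intros m.
  replace (P v - orbit_map (2 * M) n Gam P v)
    with ((P v - p (S m) v) - (orbit_map (2 * M) n Gam P v - p (S m) v)) by ring.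
  eapply Rle_trans; [apply Rabs_triang|]. rewrite Rabs_Ropp.
  pose proof (Hclose (S m) v) as H1.
  assert (H2 := orbit_map_contraction M kap g (C * th ^ m) n Gam P (p m) Hk Hg0 Hn HG HGb
    HP (Hadm m)).
  specialize (H2 ltac:(intros w; eapply Rle_trans; [apply Hclose|right; ring]) v).
  change (orbit_map (2 * M) n Gam (p m) v) with (p (S m) v) in H2. fold th in H2.
  assert (0 <= th ^ m) by (apply pow_le; lra).
  pose proof (Rabs_pos v).
  assert (0 <= C * (1 + Rabs v)) by nra.
  assert (0 <= C * (1 + Rabs v) * th ^ m) by (apply Rmult_le_pos; lra).
  simpl pow in H1. nra.
Qed.

(** At [v = 0] the average is over a constant, and what remains is the
    characteristic equation of the saddle. *)
Lemma orbit_fixed_point_at_0 (c : R) (n : nat) (Gam P : R -> R) :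
  P 0 = orbit_map c n Gam P 0 -> 0 < P 0 -> P 0 ^ 2 + c * P 0 - Gam 0 = 0.
Proof.
  intros HP HP0.
  assert (Hp := is_RInt_pow01 (n + 2) (relaxed_rhs c n Gam P 0)).
  assert (H : P 0 = relaxed_rhs c n Gam P 0 / INR (S (n + 2))).
  { rewrite HP at 1. apply is_RInt_unique. eapply is_RInt_ext; [|exact Hp].
    intros s Hs. unfold kernel. rewrite Rabs_R0, !Rmult_0_l.
    match goal with |- ?a = ?b => change (@eq R a b) end. field. }
  rewrite S_INR in H. pose proof (pos_INR (n + 2)).
  apply Rmult_eq_compat_r with (r := (INR (n + 2) + 1) * P 0) in H.
  unfold relaxed_rhs in H.
  replace ((- c + Gam 0 / P 0 + INR (n + 2) * P 0) / (INR (n + 2) + 1) *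
    ((INR (n + 2) + 1) * P 0)) with (- c * P 0 + Gam 0 + INR (n + 2) * P 0 ^ 2) in H
    by (field; lra).
  nra.
Qed.

(** Undoing the scaling [w = v * s] turns the average into
    [(1 + v) ^ 2 / v ^ (k + 1)] times an integral over [0, v], which the fundamental
    theorem of calculus differentiates; the artificial term [k * P] cancels. *)
Lemma orbit_fixed_point_ode (c : R) (n : nat) (Gam P : R -> R) :
  (forall v, continuous Gam v) -> (forall v, continuous P v) ->
  (forall v, 0 < P v) -> (forall v, P v = orbit_map c n Gam P v) ->
  forall v, 0 < v ->
  is_derive P v (((v - 1) / (v + 1) * P v - c + Gam v / P v) / v).
Proof.
  intros HG HP HP0 Hfix v Hv.
  set (J := fun w => w ^ (n + 2) / (1 + Rabs w) ^ 2 * relaxed_rhs c n Gam P w).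
  assert (HJ : forall w, continuous J w).
  { intros w. unfold J.
    pose proof (Rabs_pos w).
    apply (continuous_mult (K := R_AbsRing)).
    - apply (continuous_mult (K := R_AbsRing)).
      + apply differentiable_continuous; auto_derive; auto.
      + apply continuous_Rinv_comp.
        * apply (continuous_comp (fun w => 1 + Rabs w) (fun x => x ^ 2)).
          -- apply (continuous_plus (V := R_NormedModule));
               [apply continuous_const|apply continuous_Rabs].
          -- apply differentiable_continuous; auto_derive; auto.
        * apply pow_nonzero; lra.
    - apply relaxed_rhs_continuous; auto. specialize (HP0 w); lra. }
  assert (HJi : forall b, ex_RInt J 0 b).
  { intros b. apply (ex_RInt_continuous (V := R_CompleteNormedModule)); auto. }
  assert (Hrep : forall w, 0 < w -> P w = (1 + w) ^ 2 / w ^ (n + 3) * RInt J 0 w).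
  { intros w Hw. rewrite Hfix. unfold orbit_map.
    assert (Hlin := RInt_comp_lin (V := R_CompleteNormedModule) J w 0 0 1).
    rewrite Rmult_0_r, Rmult_1_r, !Rplus_0_r in Hlin. rewrite <- Hlin; auto.
    apply is_RInt_unique.
    assert (Hw3 : 0 < w ^ (n + 3)) by (apply pow_lt; lra).
    assert (Hc : ex_RInt (fun y => scal w (J (w * y + 0))) 0 1).
    { apply (ex_RInt_comp_lin (V := R_NormedModule)).
      rewrite Rmult_0_r, Rmult_1_r, !Rplus_0_r. apply HJi. }
    apply (RInt_correct (V := R_CompleteNormedModule)) in Hc.
    apply (is_RInt_scal (V := R_NormedModule) _ _ _ ((1 + w) ^ 2 / w ^ (n + 3))) in Hc.
    eapply is_RInt_ext; [|exact Hc].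
    intros s Hs. rewrite Rmin_left, Rmax_right in Hs by lra.
    change ((1 + w) ^ 2 / w ^ (n + 3) * (w * J (w * s + 0)) =
      kernel n w s * relaxed_rhs c n Gam P (Rabs w * s)).
    unfold J, kernel. rewrite Rplus_0_r, (Rabs_pos_eq w) by lra.
    rewrite (Rabs_pos_eq (w * s)) by nra.
    rewrite Rpow_mult_distr.
    replace (w ^ (n + 3)) with (w * w ^ (n + 2))
      by (replace (n + 3)%nat with (S (n + 2)) by lia; reflexivity) .
    assert (0 < w ^ (n + 2)) by (apply pow_lt; lra).
    field. repeat split; nra. }
  apply (is_derive_ext_loc (fun w => (1 + w) ^ 2 / w ^ (n + 3) * RInt J 0 w)).
  { exists (mkposreal v Hv). intros y Hy. symmetry; apply Hrep.
    unfold ball in Hy; simpl in Hy; unfold AbsRing_ball, abs, minus, plus, opp in Hy;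
      simpl in Hy. apply Rabs_lt_between in Hy. lra. }
  assert (HD : is_derive (RInt J 0) v (J v)).
  { apply (is_derive_RInt (V := R_NormedModule)) with (a := 0); [|apply HJ].
    apply filter_forall. intros b. apply (RInt_correct (V := R_CompleteNormedModule)), HJi. }
  assert (Hv3 : 0 < v ^ (n + 3)) by (apply pow_lt; lra).
  assert (HA : is_derive (fun w => (1 + w) ^ 2 / w ^ (n + 3)) v
    ((1 + v) ^ 2 / v ^ (n + 3) * (2 / (1 + v) - INR (n + 3) / v))).
  { auto_derive; [lra|].
    replace (Init.Nat.pred (n + 3)) with (n + 2)%nat by lia.
    replace (v ^ (n + 3)) with (v * v ^ (n + 2))
      by (replace (n + 3)%nat with (S (n + 2)) by lia; reflexivity).
    assert (0 < v ^ (n + 2)) by (apply pow_lt; lra).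
    field. repeat split; lra. }
  assert (Hm := is_derive_mult (K := R_AbsRing) _ _ _ _ _ HA HD Rmult_comm).
  match type of Hm with is_derive _ _ ?l => 
    replace (((v - 1) / (v + 1) * P v - c + Gam v / P v) / v) with l end.
  { exact Hm. }
  unfold plus, mult; simpl. rewrite <- !Rmult_assoc.
  set (A := (1 + v) * (1 + v) * 1 / v ^ (n + 3)).
  assert (HPA : P v = A * RInt J 0 v) by (rewrite (Hrep v Hv); unfold A;
      replace ((1 + v) ^ 2) with ((1 + v) * (1 + v) * 1) by ring; reflexivity).
  replace (A * (2 / (1 + v) - INR (n + 3) / v) * RInt J 0 v)
    with ((2 / (1 + v) - INR (n + 3) / v) * (A * RInt J 0 v)) by ring.
  rewrite <- HPA. unfold A, J. rewrite (Rabs_pos_eq v) by lra.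
  replace (v ^ (n + 3)) with (v * v ^ (n + 2))
      by (replace (n + 3)%nat with (S (n + 2)) by lia; reflexivity).
  assert (0 < v ^ (n + 2)) by (apply pow_lt; lra).
  unfold relaxed_rhs. specialize (HP0 v).
  replace (INR (n + 3)) with (INR (n + 2) + 1)
    by (rewrite <- S_INR; f_equal; lia).
  field. repeat split; lra.
Qed.

(** * Slope at the node *)

(** Gronwall in the time variable [ln v]: [(Y - eps) * v ^ a] is nonincreasing. *)
Lemma dissipative_eventually_small (Y dY : R -> R) (X a eps : R) :
  0 < X -> 0 < a -> 0 < eps ->
  (forall v, X <= v -> is_derive Y v (dY v)) ->
  (forall v, X <= v -> v * dY v <= - a * (Y v - eps)) ->
  exists X', forall v, X' < v -> Y v <= 2 * eps.
Proof.
  intros HX Ha He HY Hd.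
  set (Z := fun v => (Y v - eps) * exp (a * ln v)).
  set (dZ := fun v => dY v * exp (a * ln v) + (Y v - eps) * (a * / v * exp (a * ln v))).
  assert (HZ : forall v, X <= v -> is_derive Z v (dZ v)).
  { intros v Hv. unfold Z, dZ. specialize (HY v Hv).
    auto_derive; [split; [exists (dY v); exact HY|lra]|].
    replace (Derive (fun x => Y x) v) with (dY v) by (symmetry; now apply is_derive_unique).
    field; lra. }
  assert (HZd : forall v, X <= v -> dZ v <= 0).
  { intros v Hv. unfold dZ. specialize (Hd v Hv).
    pose proof (exp_pos (a * ln v)) as Hp.
    replace (dY v * exp (a * ln v) + (Y v - eps) * (a * / v * exp (a * ln v)))
      with (exp (a * ln v) * / v * (v * dY v + a * (Y v - eps))) by (field; lra).
    assert (0 < / v) by (apply Rinv_0_lt_compat; lra).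
    assert (0 < exp (a * ln v) * / v) by nra. nra. }
  assert (Hmono : forall v, X <= v -> Z v <= Z X).
  { intros v Hv. destruct (MVT_gen Z X v dZ) as [z [Hz Hzeq]].
    - rewrite Rmin_left, Rmax_right by lra. intros y Hy. apply HZ; lra.
    - rewrite Rmin_left, Rmax_right by lra. intros y Hy.
      apply continuity_pt_filterlim, differentiable_continuous.
      exists (dZ y); apply HZ; lra.
    - rewrite Rmin_left, Rmax_right in Hz by lra.
      specialize (HZd z ltac:(lra)). nra. }
  set (K := (Rabs (Z X) + 1) / eps).
  assert (HK : 0 < K) by (apply Rdiv_lt_0_compat; [pose proof (Rabs_pos (Z X))|]; lra).
  exists (Rmax X (exp (ln K / a))). intros v Hv.
  assert (HvX : X < v) by (eapply Rle_lt_trans; [apply Rmax_l|exact Hv]).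
  assert (HvK : exp (ln K / a) < v) by (eapply Rle_lt_trans; [apply Rmax_r|exact Hv]).
  assert (HE : K < exp (a * ln v)).
  { rewrite <- (exp_ln K HK) at 1. apply exp_increasing.
    apply ln_increasing in HvK; [|apply exp_pos]. rewrite ln_exp in HvK.
    apply Rmult_lt_compat_l with (r := a) in HvK; [|lra].
    replace (a * (ln K / a)) with (ln K) in HvK by (field; lra). exact HvK. }
  assert (HKe : K * eps = Rabs (Z X) + 1) by (unfold K; field; lra).
  specialize (Hmono v (Rlt_le _ _ HvX)). unfold Z at 1 in Hmono.
  pose proof (Rle_abs (Z X)).
  destruct (Rle_lt_dec (Y v) (2 * eps)) as [|Hc]; [assumption|exfalso]. nra.
Qed.

(** The slopes at the node are [M - r] and [M + r] with [r ^ 2 = M ^ 2 - G1].  An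
    orbit with [P <= M] stays a distance [r] below the fast slope, so in the time
    [ln v] the difference [V] to the slow slope obeys [V' = - A V + e] with
    [A >= r / M] and [e] tending to [0]. *)
Lemma node_limit (M kap : R) (Gam P : R -> R) (G1 : R) :
  0 < kap -> (forall v, kap <= P v <= M) -> G1 < M ^ 2 ->
  (forall v, 0 < v ->
    is_derive P v (((v - 1) / (v + 1) * P v - 2 * M + Gam v / P v) / v)) ->
  is_lim Gam p_infty G1 -> is_lim P p_infty (M - sqrt (M ^ 2 - G1)).
Proof.
  intros Hk HPb HG1 HP HG.
  set (r := sqrt (M ^ 2 - G1)).
  assert (Hr : 0 < r) by (apply sqrt_lt_R0; lra).
  assert (Hr2 : r ^ 2 = M ^ 2 - G1) by (unfold r; rewrite pow2_sqrt; lra).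
  assert (HM : 0 < M) by (specialize (HPb 0); lra).
  set (a := r / M). assert (Ha : 0 < a) by (apply Rdiv_lt_0_compat; lra).
  set (e := fun v => (Gam v - G1) / P v - 2 * P v / (1 + v)).
  set (V := fun v => P v - (M - r)).
  set (dV := fun v => ((v - 1) / (v + 1) * P v - 2 * M + Gam v / P v) / v).
  assert (HV : forall v, 0 < v -> v * dV v = - ((M + r - P v) / P v) * V v + e v).
  { intros v Hv. unfold dV, V, e. specialize (HPb v).
    replace (Gam v) with (Gam v - G1 + (M ^ 2 - r ^ 2)) at 1 by lra.
    field. repeat split; lra. }
  apply is_lim_spec. intros eps. simpl.
  set (d := eps ^ 2 / 4).
  assert (Hd : 0 < d) by (unfold d; pose proof (cond_pos eps); nra).
  (* Once [Rabs e <= 2 * q], Young's inequality gives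
     [2 * V * e <= a * V ^ 2 + a * d], since [(2 * q) ^ 2 = a ^ 2 * d]. *)
  set (q := a * sqrt d / 2).
  assert (Hsd : 0 < sqrt d) by now apply sqrt_lt_R0.
  assert (Hq : 0 < q) by (unfold q; nra).
  assert (Hqk : 0 < q * kap) by nra.
  apply is_lim_spec in HG. destruct (HG (mkposreal _ Hqk)) as [X1 HX1]. simpl in HX1.
  set (X := Rmax 1 (Rmax (X1 + 1) (2 * M / q))).
  assert (HXa : 1 <= X) by apply Rmax_l.
  assert (HXb : X1 + 1 <= X) by (eapply Rle_trans; [apply Rmax_l|apply Rmax_r]).
  assert (HXc : 2 * M / q <= X) by (eapply Rle_trans; [apply Rmax_r|apply Rmax_r]).
  assert (He : forall v, X <= v -> Rabs (e v) <= 2 * q).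
  { intros v Hv. unfold e. eapply Rle_trans; [apply Rabs_triang|].
    rewrite Rabs_Ropp. specialize (HX1 v ltac:(lra)). specialize (HPb v).
    assert (Rabs ((Gam v - G1) / P v) <= q).
    { unfold Rdiv. rewrite Rabs_mult, Rabs_inv, (Rabs_pos_eq (P v)) by lra.
      apply Rmult_le_reg_r with (P v); [lra|].
      rewrite Rmult_assoc, Rinv_l, Rmult_1_r by lra. nra. }
    assert (Rabs (2 * P v / (1 + v)) <= q).
    { assert (HqX : 2 * M <= q * X).
      { apply Rmult_le_compat_l with (r := q) in HXc; [|lra].
        replace (q * (2 * M / q)) with (2 * M) in HXc by (field; lra). exact HXc. }
      rewrite Rabs_pos_eq.
      - apply Rmult_le_reg_r with (1 + v); [lra|].
        replace (2 * P v / (1 + v) * (1 + v)) with (2 * P v) by (field; lra). nra.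
      - apply Rdiv_le_0_compat; lra. }
    lra. }
  destruct (dissipative_eventually_small (fun v => V v ^ 2)
    (fun v => 2 * V v * dV v) X a d) as [X' HX']; try lra.
  - intros v Hv. unfold V. specialize (HP v ltac:(lra)). fold (dV v) in HP.
    auto_derive; [exists (dV v); exact HP|].
    replace (Derive (fun x => P x) v) with (dV v) by (symmetry; now apply is_derive_unique).
    ring.
  - intros v Hv. specialize (HV v ltac:(lra)). specialize (He v Hv). specialize (HPb v).
    replace (v * (2 * V v * dV v)) with (2 * V v * (v * dV v)) by ring.
    rewrite HV.
    assert (Hax : a <= (M + r - P v) / P v).
    { unfold a. apply Rmult_le_reg_r with (P v); [lra|].
      replace ((M + r - P v) / P v * P v) with (M + r - P v) by (field; lra).
      apply Rmult_le_reg_r with M; [lra|].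
      replace (r / M * P v * M) with (r * P v) by (field; lra). nra. }
    set (A := (M + r - P v) / P v) in *. set (y := V v) in *. set (E := e v) in *.
    assert (HE2 : E ^ 2 <= a ^ 2 * d).
    { replace (a ^ 2 * d) with ((2 * q) ^ 2).
      - apply Rabs_le_between in He. nra.
      - unfold q. rewrite <- (pow2_sqrt d) at 2 by lra. field. }
    assert (Hy : 2 * y * E <= a * y ^ 2 + a * d).
    { apply Rmult_le_reg_r with a; [lra|].
      pose proof (pow2_ge_0 (a * y - E)). nra. }
    pose proof (pow2_ge_0 y). nra.
  - exists X'. intros v Hv. specialize (HX' v Hv). fold (V v).
    pose proof (cond_pos eps).
    apply Rabs_lt_between. unfold d in HX'. nra.
Qed.

(** The normalised orbit: [Q = x * (1 - x) * P x] leaves the saddle [x = 0], enters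
    the node [x = 1] and satisfies [Q' = - 2 * M + G / P], that is,
    [Q * Q' = - 2 * M * Q + x * (1 - x) * G].  It is the fixed point read in the
    coordinate [v = x / (1 - x)]. *)
Lemma saddle_node_orbit (M g : R) (G : R -> R) :
  0 < M -> 0 < g -> (forall x, continuous G x) ->
  (forall x, 0 <= x <= 1 -> g <= G x <= M ^ 2) ->
  exists P : R -> R,
    (forall x, 0 <= x <= 1 -> 0 < P x <= M) /\
    (forall x, 0 <= x < 1 -> continuous P x) /\
    P 0 ^ 2 + 2 * M * P 0 - G 0 = 0 /\
    (forall x, 0 < x < 1 -> is_derive P x
       (((2 * x - 1) * P x - 2 * M + G x / P x) / (x * (1 - x)))) /\
    (G 1 < M ^ 2 -> continuous P 1 /\ P 1 = M - sqrt (M ^ 2 - G 1)).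
Proof.
  intros HM Hg HG HGb.
  assert (HgM : g <= M ^ 2) by (specialize (HGb 0); lra).
  set (kap := g / (3 * M)).
  assert (Hkap : 0 < kap) by (apply Rdiv_lt_0_compat; lra).
  assert (HkM : 3 * M * kap = g) by (unfold kap; field; lra).
  assert (HkM' : kap <= M) by nra.
  (* The value of [kap] above makes the constant [kap] a lower solution; this [n]
     makes the relaxed right-hand side increasing on the whole band. *)
  destruct (INR_unbounded (M ^ 2 / kap ^ 2)) as [n Hn].
  assert (Hn' : M ^ 2 <= INR (n + 2) * kap ^ 2).
  { assert (0 < kap ^ 2) by nra.
    apply Rmult_lt_compat_r with (r := kap ^ 2) in Hn; [|lra].
    replace (M ^ 2 / kap ^ 2 * kap ^ 2) with (M ^ 2) in Hn by (field; lra).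
    rewrite plus_INR. simpl INR. nra. }
  set (Gam := fun v => G (Rabs v / (1 + Rabs v))).
  assert (Hx : forall v, 0 <= Rabs v / (1 + Rabs v) <= 1).
  { intros v. pose proof (Rabs_pos v). split.
    - apply Rdiv_le_0_compat; lra.
    - apply Rmult_le_reg_r with (1 + Rabs v); [lra|].
      replace (Rabs v / (1 + Rabs v) * (1 + Rabs v)) with (Rabs v) by (field; lra). lra. }
  assert (HGam : forall v, continuous Gam v).
  { intros v. pose proof (Rabs_pos v). unfold Gam.
    apply (continuous_comp Rabs (fun a => G (a / (1 + a)))); [apply continuous_Rabs|].
    apply (continuous_comp (fun a => a / (1 + a)) G); [|apply HG].
    apply differentiable_continuous. auto_derive. lra. }
  assert (HGamb : forall v, g <= Gam v <= M ^ 2) by (intros v; apply HGb, Hx).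
  destruct (orbit_fixed_point_exists M kap g n Gam) as (Q & [HQ HQb] & Hfix);
    try assumption; try lra.
  assert (HQ0 : forall v, 0 < Q v) by (intros v; specialize (HQb v); lra).
  assert (Hode := orbit_fixed_point_ode (2 * M) n Gam Q HGam HQ HQ0 Hfix).
  assert (H0 := orbit_fixed_point_at_0 (2 * M) n Gam Q (Hfix 0) (HQ0 0)).
  assert (HGam0 : Gam 0 = G 0) by (unfold Gam; rewrite Rabs_R0; f_equal; field).
  assert (Hs : 0 <= sqrt (M ^ 2 - G 1) < M).
  { specialize (HGb 1 ltac:(lra)). split; [apply sqrt_pos|].
    rewrite <- (sqrt_pow2 M) at 2 by lra. apply sqrt_lt_1; lra. }
  set (P := fun x => if Rlt_dec x 1 then Q (x / (1 - x)) else M - sqrt (M ^ 2 - G 1)).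
  assert (HPin : forall x, x < 1 -> P x = Q (x / (1 - x))).
  { intros x Hx1. unfold P. destruct (Rlt_dec x 1); [reflexivity|lra]. }
  assert (HP1 : forall x, 1 <= x -> P x = M - sqrt (M ^ 2 - G 1)).
  { intros x Hx1. unfold P. destruct (Rlt_dec x 1); [lra|reflexivity]. }
  assert (Hloc : forall x, x < 1 -> locally x (fun y => Q (y / (1 - y)) = P y)).
  { intros x Hx1. assert (Hp : 0 < 1 - x) by lra.
    exists (mkposreal _ Hp). intros y Hy. symmetry; apply HPin.
    apply Rabs_lt_between in Hy. unfold minus, plus, opp in Hy. simpl in Hy. lra. }
  exists P. split; [|split; [|split; [|split]]].
  - intros x _. destruct (Rlt_dec x 1) as [Hx1|Hx1].
    + rewrite HPin by assumption. split; [apply HQ0|apply HQb].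
    + rewrite HP1 by lra. lra.
  - intros x Hx1. apply (continuous_ext_loc _ _ _ (Hloc x (proj2 Hx1))).
    apply (continuous_comp (fun y => y / (1 - y)) Q); [|apply HQ].
    apply differentiable_continuous. auto_derive. lra.
  - rewrite HPin by lra. replace (0 / (1 - 0)) with 0 by field. rewrite <- HGam0. exact H0.
  - intros x Hx1. apply (is_derive_ext_loc _ _ _ _ (Hloc x (proj2 Hx1))).
    rewrite HPin by lra.
    assert (Hv : 0 < x / (1 - x)) by (apply Rdiv_lt_0_compat; lra).
    specialize (Hode _ Hv).
    assert (Hd : is_derive (fun y => y / (1 - y)) x (/ (1 - x) ^ 2)).
    { auto_derive; [lra|]. field. lra. }
    assert (Hc := is_derive_comp Q (fun y => y / (1 - y)) x _ _ Hode Hd).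
    replace (Gam (x / (1 - x))) with (G x) in Hc.
    2:{ unfold Gam. rewrite Rabs_pos_eq by lra. f_equal. field. lra. }
    evar_last; [exact Hc|].
    unfold scal; simpl; unfold mult; simpl.
    specialize (HQ0 (x / (1 - x))). field. repeat split; lra.
  - intros Hstrict. split; [|apply HP1; lra].
    apply continuity_pt_filterlim. intros eps Heps.
    assert (HlG : is_lim Gam p_infty (G 1)).
    { apply is_lim_spec. intros e. simpl.
      assert (Hc := HG 1). apply continuity_pt_filterlim in Hc.
      destruct (Hc e (cond_pos e)) as (d & Hd & HdG).
      exists (/ d). intros v Hv.
      assert (Hd' : 0 < / d) by (apply Rinv_0_lt_compat; lra).
      unfold Gam. rewrite (Rabs_pos_eq v) by lra.
      apply HdG. split; [split; [exact I|]|].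
      - intros Heq. apply Rmult_eq_compat_r with (r := 1 + v) in Heq.
        replace (v / (1 + v) * (1 + v)) with v in Heq by (field; lra). lra.
      - simpl. unfold R_dist.
        replace (v / (1 + v) - 1) with (- / (1 + v)) by (field; lra).
        rewrite Rabs_Ropp, Rabs_pos_eq by (left; apply Rinv_0_lt_compat; lra).
        rewrite <- (Rinv_inv d). apply Rinv_lt_contravar; nra. }
    assert (Hl := node_limit M kap Gam Q (G 1) Hkap HQb Hstrict Hode HlG).
    apply is_lim_spec in Hl. destruct (Hl (mkposreal eps Heps)) as [X HX]. simpl in HX.
    set (X' := Rmax 1 X).
    assert (HX1 : 1 <= X') by apply Rmax_l.
    assert (HX2 : X <= X') by apply Rmax_r.
    exists (/ (1 + X')). split; [apply Rinv_0_lt_compat; lra|].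
    intros x [_ Hx1]. simpl in *. unfold R_dist in *.
    rewrite (HP1 1) by lra.
    destruct (Rlt_dec x 1) as [Hlt|Hge].
    + rewrite HPin by assumption. apply HX.
      apply Rabs_lt_between in Hx1.
      assert (Hy : (1 - x) * (1 + X') < 1).
      { apply Rmult_lt_reg_r with (/ (1 + X')); [apply Rinv_0_lt_compat; lra|].
        replace ((1 - x) * (1 + X') * / (1 + X')) with (1 - x) by (field; lra). lra. }
      apply Rle_lt_trans with X'; [lra|].
      apply Rmult_lt_reg_r with (1 - x); [lra|].
      replace (x / (1 - x) * (1 - x)) with x by (field; lra). lra.
    + rewrite HP1 by lra. rewrite Rminus_eq_0, Rabs_R0. lra.
Qed.

(** * Orbits on the three segments and their union *)

(** Membership in the segment from [a] to [b], in either orientation, is expressed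
    by products that are polynomial in [u]. *)
Lemma segment_coordinate (a b u : R) : a <> b ->
  let x := (u - a) / (b - a) in
  (0 <= (u - a) * (b - a) -> 0 <= x) /\ (0 < (u - a) * (b - a) -> 0 < x) /\
  ((u - a) * (b - a) < (b - a) ^ 2 -> x < 1) /\
  ((u - a) * (b - a) <= (b - a) ^ 2 -> x <= 1).
Proof.
  intros Hab x.
  assert (Hsq : 0 < (b - a) ^ 2) by (apply pow2_gt_0; lra).
  assert (Hx : (u - a) * (b - a) = x * (b - a) ^ 2) by (unfold x; field; lra).
  rewrite Hx. repeat split; intros H; nra.
Qed.

(** The orbit transported to the segment from a saddle [a] to a node [b], in either
    order, with [H = P / gam].  If [- (u - a) * (b - u) / (b - a) * gam u] is the
    product of diffusivity and reaction, then [H] is the decay rate [- u'] divided by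
    the reaction, a quotient that stays finite and positive at both ends.  Its values
    there depend only on [gam a] and, if [gam b < M ^ 2], on [gam b];
    this is what makes neighbouring segments fit together. *)
Lemma orbit_on_segment (M g a b : R) (gam : R -> R) :
  0 < M -> 0 < g -> a <> b -> (forall u, continuous gam u) ->
  (forall u, 0 <= (u - a) * (b - a) <= (b - a) ^ 2 -> g <= gam u <= M ^ 2) ->
  exists H : R -> R,
    (forall u, 0 <= (u - a) * (b - a) <= (b - a) ^ 2 -> 0 < H u <= M / g) /\
    (forall u, 0 <= (u - a) * (b - a) < (b - a) ^ 2 -> continuous H u) /\
    gam a * H a ^ 2 + 2 * M * H a = 1 /\
    (forall u, 0 < (u - a) * (b - a) < (b - a) ^ 2 ->
      is_derive (fun u => - (u - a) * (b - u) / (b - a) * gam u * H u) u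
        (2 * M - / H u)) /\
    (gam b < M ^ 2 ->
      continuous H b /\ H b = (M - sqrt (M ^ 2 - gam b)) / gam b).
Proof.
  intros HM Hg Hab Hgam Hb.
  assert (Hsq : 0 < (b - a) ^ 2) by (apply pow2_gt_0; lra).
  set (G := fun x => gam (a + (b - a) * x)).
  assert (HG : forall x, continuous G x).
  { intros x. apply (continuous_comp (fun x => a + (b - a) * x) gam); [|apply Hgam].
    apply differentiable_continuous. auto_derive. exact I. }
  destruct (saddle_node_orbit M g G HM Hg HG) as (P & HPb & HPc & HP0 & HPd & HP1).
  { intros x Hx. apply Hb. nra. }
  set (xi := fun u => (u - a) / (b - a)).
  assert (Hxi : forall u, gam u = G (xi u))
    by (intros u; unfold G, xi; f_equal; field; lra).
  assert (Hxic : forall u, continuous xi u).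
  { intros u. apply differentiable_continuous. unfold xi. auto_derive. lra. }
  assert (HPxi : forall u, continuous P (xi u) -> continuous (fun u => P (xi u)) u).
  { intros u Hu. apply (continuous_comp xi P); [apply Hxic|exact Hu]. }
  assert (Hquot : forall u, gam u <> 0 -> continuous P (xi u) ->
    continuous (fun u => P (xi u) / gam u) u).
  { intros u Hu Hc. apply (continuous_mult (K := R_AbsRing)); [now apply HPxi|].
    apply continuous_Rinv_comp; [apply Hgam|exact Hu]. }
  assert (Hga : g <= gam a) by (apply Hb; nra).
  assert (Hgb : g <= gam b) by (apply Hb; nra).
  assert (Hxa : xi a = 0) by (unfold xi; field; lra).
  assert (Hxb : xi b = 1) by (unfold xi; field; lra).
  exists (fun u => P (xi u) / gam u). split; [|split; [|split; [|split]]].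
  - intros u Hu. specialize (Hb u Hu).
    destruct (segment_coordinate a b u Hab) as (S1 & _ & _ & S4). fold (xi u) in *.
    destruct (HPb (xi u) ltac:(split; [apply S1|apply S4]; lra)) as [Hp1 Hp2].
    split; [apply Rdiv_lt_0_compat; lra|].
    apply Rmult_le_compat; [lra| |lra|apply Rinv_le_contravar; lra].
    left; apply Rinv_0_lt_compat; lra.
  - intros u Hu. specialize (Hb u ltac:(lra)).
    destruct (segment_coordinate a b u Hab) as (S1 & _ & S3 & _). fold (xi u) in *.
    apply Hquot; [lra|]. apply HPc. split; [apply S1|apply S3]; lra.
  - rewrite Hxa. assert (HG0 : G 0 = gam a) by (rewrite Hxi, Hxa; reflexivity).
    rewrite HG0 in HP0.
    apply Rmult_eq_reg_r with (gam a); [|lra].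
    replace ((gam a * (P 0 / gam a) ^ 2 + 2 * M * (P 0 / gam a)) * gam a)
      with (P 0 ^ 2 + 2 * M * P 0) by (field; lra). lra.
  - intros u Hu.
    destruct (segment_coordinate a b u Hab) as (_ & S2 & S3 & _). fold (xi u) in *.
    assert (Hx : 0 < xi u < 1) by (split; [apply S2|apply S3]; lra).
    destruct (HPb (xi u) ltac:(lra)) as [Hp1 Hp2].
    specialize (HPd (xi u) Hx). set (dP := (_ / _)) in HPd.
    assert (HF : is_derive (fun x => - (b - a) * (x * (1 - x) * P x)) (xi u)
      (- (b - a) * ((1 - 2 * xi u) * P (xi u) + xi u * (1 - xi u) * dP))).
    { auto_derive; [exists dP; exact HPd|].
      replace (Derive (fun x => P x) (xi u)) with dP
        by (symmetry; now apply is_derive_unique). ring. }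
    assert (Hdxi : is_derive xi u (/ (b - a))).
    { unfold xi. auto_derive; [lra|]. field. lra. }
    assert (Hc := is_derive_comp (fun x => - (b - a) * (x * (1 - x) * P x)) xi u _ _ HF Hdxi).
    specialize (Hb u ltac:(lra)).
    assert (Hloc : locally u (fun y => - (b - a) * (xi y * (1 - xi y) * P (xi y)) =
      - (y - a) * (b - y) / (b - a) * gam y * (P (xi y) / gam y))).
    { assert (Hne : locally u (fun y => gam y <> 0)).
      { apply (Hgam u (fun z => z <> 0)).
        apply (open_neq 0). lra. }
      revert Hne. apply filter_imp. intros y Hy. unfold xi. field. lra. }
    apply (is_derive_ext_loc _ _ _ _ Hloc).
    evar_last; [exact Hc|].
    unfold scal; simpl; unfold mult; simpl. unfold dP. rewrite Hxi.
    assert (0 < G (xi u)) by (rewrite <- Hxi; lra).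
    field. repeat split; lra.
  - intros Hs. assert (HG1 : G 1 = gam b) by (rewrite Hxi, Hxb; reflexivity).
    rewrite HG1 in HP1. destruct (HP1 Hs) as [Hc1 Hv1]. split.
    + apply Hquot; [lra|]. rewrite Hxb. exact Hc1.
    + rewrite Hxb, Hv1. reflexivity.
Qed.

Definition glue (a : R) (f g : R -> R) (u : R) : R := if Rlt_dec u a then f u else g u.

Lemma glue_left a f g u : u < a -> locally u (fun y => f y = glue a f g y).
Proof.
  intros Hu. apply (filter_imp (fun y => y < a)); [|now apply open_lt].
  intros y Hy. unfold glue. destruct (Rlt_dec y a); [reflexivity|lra].
Qed.

Lemma glue_right a f g u : a < u -> locally u (fun y => g y = glue a f g y).
Proof.
  intros Hu. apply (filter_imp (fun y => a < y)); [|now apply open_gt].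
  intros y Hy. unfold glue. destruct (Rlt_dec y a); [lra|reflexivity].
Qed.

Lemma glue_continuous a f g :
  continuous f a -> continuous g a -> f a = g a -> continuous (glue a f g) a.
Proof.
  intros Hf Hg Heq P HP.
  assert (Ha : glue a f g a = g a).
  { unfold glue. destruct (Rlt_dec a a); [lra|reflexivity]. }
  rewrite Ha in HP.
  specialize (Hg P HP). rewrite <- Heq in HP. specialize (Hf P HP).
  unfold filtermap in *. generalize (filter_and _ _ Hf Hg). apply filter_imp.
  intros y [H1 H2]. unfold glue. now destruct (Rlt_dec y a).
Qed.

(** At a zero of the diffusivity the flux is differentiable as soon as the decay
    rate is continuous, whether or not the latter is differentiable. *)
Lemma is_derive_mult_zero (k H : R -> R) (a : R) :
  continuous k a -> continuous H a ->
  is_derive (fun u => (u - a) * k u * H u) a (k a * H a).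
Proof.
  intros Hk HH.
  assert (Hc : continuous (fun u => k u * H u) a)
    by (apply (continuous_mult (K := R_AbsRing)); assumption).
  apply is_derive_Reals. intros eps Heps.
  apply continuity_pt_filterlim in Hc. destruct (Hc eps Heps) as (d & Hd & Hdc).
  exists (mkposreal d Hd). intros h Hh0 Hh. simpl in Hh.
  replace (((a + h - a) * k (a + h) * H (a + h) - (a - a) * k a * H a) / h - k a * H a)
    with (k (a + h) * H (a + h) - k a * H a) by (field; exact Hh0).
  apply Hdc. split; [split; [exact I|lra]|].
  simpl. unfold R_dist. replace (a + h - a) with h by ring. exact Hh.
Qed.

(** From saddle to node, the three orbits join [al] to [0], [al] to [be] and [1] to [be].
    At [al] both neighbours take the positive root of one quadratic, at [be] both take
    the small root of another, so that their union is continuous; and these same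
    quadratics are the orbit equation at the degenerate points.  The three
    inequalities bound the three factors [gam] by [M ^ 2]; only at [be], where two
    orbits have to meet with equal slopes, must the bound be strict. *)
Lemma heteroclinic_orbit (m al be M : R) :
  0 < m -> 0 < M -> 0 < al -> al < be -> be < 1 ->
  m * al * be <= M ^ 2 ->
  m * (be - al) * / 4 < M ^ 2 ->
  m * (1 - be) * (1 - al) < M ^ 2 ->
  exists (H : R -> R) (C : R), forall u, 0 < u < 1 ->
    continuous H u /\ 0 < H u <= C /\
    is_derive (fun u => m * (u - al) * (u - be) * (u * (1 - u)) * H u) u
      (2 * M - / H u).
Proof.
  intros Hm HM Ha Hab Hb1 B1 B2 B3.
  (* [m * (u - al) * (u - be) * u * (1 - u)] divided by
     [- (u - a) * (b - u) / (b - a)] for each of the three pairs [(a, b)]. *)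
  set (g1 := fun u => m * al * (be - u) * (1 - u)).
  set (g2 := fun u => m * (be - al) * u * (1 - u)).
  set (g3 := fun u => m * (1 - be) * (u - al) * u).
  assert (Hma : 0 < m * al) by nra.
  assert (Hmab : 0 < m * (be - al)) by nra.
  assert (Hmb : 0 < m * (1 - be)) by nra.
  assert (C1 : forall u, continuous g1 u) by
    (intros u; apply differentiable_continuous; unfold g1; auto_derive; exact I).
  assert (C2 : forall u, continuous g2 u) by
    (intros u; apply differentiable_continuous; unfold g2; auto_derive; exact I).
  assert (C3 : forall u, continuous g3 u) by
    (intros u; apply differentiable_continuous; unfold g3; auto_derive; exact I).
  destruct (orbit_on_segment M (m * al * (be - al) * (1 - al)) al 0 g1)
    as (H1 & P1 & K1 & S1 & D1 & _); try assumption; try lra.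
  { apply Rmult_lt_0_compat; [nra|lra]. }
  { intros u Hu. assert (Hu' : 0 <= u <= al) by nra. unfold g1.
    assert (E1 : (be - al) * (1 - al) <= (be - u) * (1 - u)) by nra.
    assert (E2 : (be - u) * (1 - u) <= be) by nra.
    rewrite !Rmult_assoc in *. split; nra. }
  destruct (orbit_on_segment M (m * (be - al) * (al * (1 - be))) al be g2)
    as (H2 & P2 & K2 & S2 & D2 & N2); try assumption; try lra.
  { apply Rmult_lt_0_compat; nra. }
  { intros u Hu. assert (Hu' : al <= u <= be) by nra. unfold g2.
    assert (E1 : al * (1 - be) <= u * (1 - u)) by nra.
    assert (E2 : u * (1 - u) <= / 4) by (pose proof (pow2_ge_0 (u - / 2)); nra).
    rewrite (Rmult_assoc _ u). split; nra. }
  destruct (orbit_on_segment M (m * (1 - be) * ((be - al) * be)) 1 be g3)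
    as (H3 & P3 & K3 & _ & D3 & N3); try assumption; try lra.
  { apply Rmult_lt_0_compat; nra. }
  { intros u Hu. assert (Hu' : be <= u <= 1) by nra. unfold g3.
    assert (E1 : (be - al) * be <= (u - al) * u) by nra.
    assert (E2 : (u - al) * u <= 1 - al) by nra.
    rewrite (Rmult_assoc _ (u - al)). split; nra. }
  assert (E12 : g1 al = g2 al) by (unfold g1, g2; ring).
  assert (E23 : g2 be = g3 be) by (unfold g2, g3; ring).
  assert (L2 : g2 be < M ^ 2).
  { unfold g2. assert (be * (1 - be) <= / 4) by (pose proof (pow2_ge_0 (be - / 2)); nra).
    rewrite (Rmult_assoc _ be). nra. }
  assert (G2a : 0 < g2 al) by (unfold g2; repeat apply Rmult_lt_0_compat; lra).
  assert (G2b : 0 < g2 be) by (unfold g2; repeat apply Rmult_lt_0_compat; lra).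
  destruct (N2 L2) as [N2c N2v].
  rewrite E23 in L2. destruct (N3 L2) as [N3c N3v]. rewrite <- E23 in N3v, L2.
  assert (H1a : 0 < H1 al) by (apply P1; nra).
  assert (H2a : 0 < H2 al) by (apply P2; nra).
  assert (H2b : 0 < H2 be) by (apply P2; nra).
  (* The positive root of [g2 al * h ^ 2 + 2 * M * h = 1] is unique. *)
  assert (M12 : H1 al = H2 al).
  { rewrite E12 in S1.
    assert (HH : (H1 al - H2 al) * (g2 al * (H1 al + H2 al) + 2 * M) = 0) by nra.
    apply Rmult_integral in HH. destruct HH as [HH|HH]; [lra|].
    assert (0 < g2 al * (H1 al + H2 al)) by nra. lra. }
  assert (M23 : H2 be = H3 be) by (rewrite N2v, N3v; reflexivity).
  assert (S2b : g2 be * H2 be ^ 2 - 2 * M * H2 be + 1 = 0).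
  { rewrite N2v. set (r := sqrt (M ^ 2 - g2 be)).
    assert (Hr : g2 be = M ^ 2 - r ^ 2) by (unfold r; rewrite pow2_sqrt; lra).
    rewrite Hr. field. lra. }
  set (H := glue al H1 (glue be H2 H3)).
  set (K := fun u => m * (u - al) * (u - be) * (u * (1 - u))).
  exists H, (Rmax (M / (m * al * (be - al) * (1 - al)))
    (Rmax (M / (m * (be - al) * (al * (1 - be)))) (M / (m * (1 - be) * ((be - al) * be))))).
  set (Cm := Rmax _ _).
  assert (X1 : M / (m * al * (be - al) * (1 - al)) <= Cm) by apply Rmax_l.
  assert (X2 : M / (m * (be - al) * (al * (1 - be))) <= Cm)
    by (eapply Rle_trans; [apply Rmax_l|apply Rmax_r]).
  assert (X3 : M / (m * (1 - be) * ((be - al) * be)) <= Cm)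
    by (eapply Rle_trans; [apply Rmax_r|apply Rmax_r]).
  assert (V1 : forall u, u < al -> H u = H1 u).
  { intros u Hu. unfold H, glue. destruct (Rlt_dec u al); [reflexivity|lra]. }
  assert (V2 : forall u, al <= u < be -> H u = H2 u).
  { intros u Hu. unfold H, glue. destruct (Rlt_dec u al); [lra|].
    destruct (Rlt_dec u be); [reflexivity|lra]. }
  assert (V3 : forall u, be <= u -> H u = H3 u).
  { intros u Hu. unfold H, glue. destruct (Rlt_dec u al); [lra|].
    destruct (Rlt_dec u be); [lra|reflexivity]. }
  assert (L1 : forall u, u < al -> locally u (fun y => H1 y = H y))
    by (intros u Hu; now apply glue_left).
  assert (L2' : forall u, al < u < be -> locally u (fun y => H2 y = H y)).
  { intros u Hu.
    generalize (filter_and _ _ (glue_right al H1 (glue be H2 H3) u (proj1 Hu))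
      (glue_left be H2 H3 u (proj2 Hu))).
    apply filter_imp. intros y [Y1 Y2]. rewrite Y2. exact Y1. }
  assert (L3 : forall u, be < u -> locally u (fun y => H3 y = H y)).
  { intros u Hu. assert (Hau : al < u) by lra.
    generalize (filter_and _ _ (glue_right al H1 (glue be H2 H3) u Hau)
      (glue_right be H2 H3 u Hu)).
    apply filter_imp. intros y [Y1 Y2]. rewrite Y2. exact Y1. }
  assert (Trans : forall Hi ci u, locally u (fun y => Hi y = H y) ->
    (forall y, ci y = K y) ->
    is_derive (fun y => ci y * Hi y) u (2 * M - / Hi u) ->
    is_derive (fun y => K y * H y) u (2 * M - / H u)).
  { intros Hi ci u Hl Hk Hd. rewrite <- (locally_singleton _ _ Hl).
    refine (is_derive_ext_loc _ _ _ _ _ Hd). revert Hl. apply filter_imp.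
    intros y Hy. rewrite Hk, Hy. reflexivity. }
  intros u Hu.
  destruct (Rtotal_order u al) as [Hl|[He|Hg]];
    [| |destruct (Rtotal_order u be) as [Hl|[He|Hg']]].
  - split; [|split].
    + apply (continuous_ext_loc _ _ _ (L1 u Hl)), K1. nra.
    + rewrite V1 by lra. destruct (P1 u) as [Q1 Q2]; [nra|lra].
    + refine (Trans _ _ _ (L1 u Hl) _ (D1 u _)); [|nra].
      intros y. unfold K, g1. field. lra.
  - subst u.
    assert (Hc : continuous H al).
    { apply glue_continuous.
      - apply K1. nra.
      - apply (continuous_ext_loc _ _ _ (glue_left be H2 H3 al Hab)), K2. nra.
      - unfold glue. destruct (Rlt_dec al be); [exact M12|lra]. }
    rewrite V2 by lra. split; [exact Hc|split].
    + destruct (P2 al) as [Q1 Q2]; [nra|lra].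
    + assert (Hd := is_derive_mult_zero (fun u => m * (u - be) * (u * (1 - u))) H al
        ltac:(apply differentiable_continuous; auto_derive; exact I) Hc).
      cbv beta in Hd. rewrite V2 in Hd by lra.
      replace (2 * M - / H2 al) with (m * (al - be) * (al * (1 - al)) * H2 al).
      * eapply is_derive_ext; [|exact Hd]. intros t. simpl. ring.
      * apply Rmult_eq_reg_r with (H2 al); [|lra].
        replace ((2 * M - / H2 al) * H2 al) with (2 * M * H2 al - 1) by (field; lra).
        unfold g2 in S2. lra.
  - split; [|split].
    + apply (continuous_ext_loc _ _ _ (L2' u (conj Hg Hl))), K2. nra.
    + rewrite V2 by lra. destruct (P2 u) as [Q1 Q2]; [nra|lra].
    + refine (Trans _ _ _ (L2' u (conj Hg Hl)) _ (D2 u _)); [|nra].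
      intros y. unfold K, g2. field. lra.
  - subst u.
    assert (Hc : continuous H be).
    { apply (continuous_ext_loc _ _ _ (glue_right al H1 (glue be H2 H3) be Hab)).
      apply glue_continuous; assumption. }
    rewrite V3, <- M23 by lra. split; [exact Hc|split].
    + destruct (P2 be) as [Q1 Q2]; [nra|lra].
    + assert (Hd := is_derive_mult_zero (fun u => m * (u - al) * (u * (1 - u))) H be
        ltac:(apply differentiable_continuous; auto_derive; exact I) Hc).
      cbv beta in Hd. rewrite V3, <- M23 in Hd by lra.
      replace (2 * M - / H2 be) with (m * (be - al) * (be * (1 - be)) * H2 be).
      * eapply is_derive_ext; [|exact Hd]. intros t. simpl. ring.
      * apply Rmult_eq_reg_r with (H2 be); [|lra].
        replace ((2 * M - / H2 be) * H2 be) with (2 * M * H2 be - 1) by (field; lra).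
        unfold g2 in S2b. lra.
  - split; [|split].
    + apply (continuous_ext_loc _ _ _ (L3 u Hg')).
      apply K3. nra.
    + rewrite V3 by lra. destruct (P3 u) as [Q1 Q2]; [nra|lra].
    + refine (Trans _ _ _ (L3 u Hg') _ (D3 u _)); [|nra].
      intros y. unfold K, g3. field. lra.
Qed.

(** * From the phase plane to the travelling wave *)

(** Separation of variables: [Y] inverts the integral [Z] of [1 / h], whose slope is
    at least [1 / C], so that [Z] maps [R] onto [R].  The mean value theorem for [Z]
    then differentiates [Y] directly. *)
Lemma autonomous_solution (h : R -> R) (C : R) :
  (forall y, continuous h y) -> (forall y, 0 < h y <= C) ->
  exists Y : R -> R,
    (forall z, is_derive Y z (h (Y z))) /\
    (forall x z, x <= z -> Y x <= Y z) /\
    (forall y, exists z, Y z = y).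
Proof.
  intros Hh Hb.
  assert (HC : 0 < C) by (specialize (Hb 0); lra).
  assert (Hih : forall y, continuous (fun y => / h y) y).
  { intros y. apply continuous_Rinv_comp; [apply Hh|]. specialize (Hb y); lra. }
  set (Z := RInt (fun y => / h y) 0).
  assert (HZ : forall y, is_derive Z y (/ h y)).
  { intros y. apply (is_derive_RInt (V := R_NormedModule) (fun y => / h y) Z 0 y).
    - apply filter_forall. intros b. apply (RInt_correct (V := R_CompleteNormedModule)).
      apply (ex_RInt_continuous (V := R_CompleteNormedModule)). auto.
    - apply Hih. }
  assert (HZc : forall y, continuity_pt Z y).
  { intros y. apply continuity_pt_filterlim, differentiable_continuous.
    exists (/ h y); apply HZ. }
  assert (HZ0 : Z 0 = 0) by apply (RInt_point (V := R_CompleteNormedModule)).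
  assert (Hmvt : forall a b, exists x, Rmin a b <= x <= Rmax a b /\
    b - a = h x * (Z b - Z a)).
  { intros a b. destruct (MVT_gen Z a b (fun y => / h y)) as [x [Hx Hxe]].
    - intros; apply HZ.
    - intros; apply HZc.
    - exists x. split; [exact Hx|]. rewrite Hxe. field. specialize (Hb x); lra. }
  assert (Hsurj : forall z, Rmin (Z (- (C * Rabs z))) (Z (C * Rabs z)) <= z
    <= Rmax (Z (- (C * Rabs z))) (Z (C * Rabs z))).
  { intros z. pose proof (Rabs_pos z) as Hz.
    destruct (Hmvt 0 (C * Rabs z)) as [x [_ Hx]].
    destruct (Hmvt 0 (- (C * Rabs z))) as [y [_ Hy]].
    rewrite HZ0, !Rminus_0_r in *.
    pose proof (Hb x) as Hbx. pose proof (Hb y) as Hby.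
    assert (Rabs z <= Z (C * Rabs z)).
    { apply Rmult_le_reg_l with (h x); [lra|]. nra. }
    assert (Z (- (C * Rabs z)) <= - Rabs z).
    { apply Rmult_le_reg_l with (h y); [lra|]. nra. }
    pose proof (Rle_abs z). pose proof (Rle_abs (- z)). rewrite Rabs_Ropp in *.
    rewrite Rmin_left, Rmax_right; lra. }
  set (Y := fun z => proj1_sig (IVT_gen Z _ _ z HZc (Hsurj z))).
  assert (HY : forall z, Z (Y z) = z).
  { intros z. exact (proj2 (proj2_sig (IVT_gen Z _ _ z HZc (Hsurj z)))). }
  exists Y. split; [|split].
  - intros z. apply is_derive_Reals. intros eps Heps.
    assert (Hc := Hh (Y z)). apply continuity_pt_filterlim in Hc.
    destruct (Hc eps Heps) as (d & Hd & Hdc).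
    assert (HdC : 0 < d / C) by (apply Rdiv_lt_0_compat; lra).
    exists (mkposreal _ HdC). intros k Hk0 Hk. simpl in Hk.
    destruct (Hmvt (Y z) (Y (z + k))) as [x [Hx Hxe]]. rewrite !HY in Hxe.
    replace (z + k - z) with k in Hxe by ring. rewrite Hxe.
    replace (h x * k / k) with (h x) by (field; exact Hk0).
    destruct (Req_dec x (Y z)) as [->|Hne].
    { rewrite Rminus_eq_0, Rabs_R0. lra. }
    apply Hdc. split; [split; [exact I|auto]|]. simpl. unfold R_dist.
    apply Rle_lt_trans with (Rabs (Y (z + k) - Y z)).
    { destruct (Rle_dec (Y z) (Y (z + k))) as [Hle|Hle].
      - rewrite Rmin_left, Rmax_right in Hx by lra. rewrite !Rabs_pos_eq; lra.
      - rewrite Rmin_right, Rmax_left in Hx by lra. rewrite !Rabs_left1; lra. }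
    rewrite Hxe, Rabs_mult. pose proof (Hb x) as Hbx. rewrite (Rabs_pos_eq (h x)) by lra.
    apply Rmult_lt_compat_r with (r := C) in Hk; [|lra].
    replace (d / C * C) with d in Hk by (field; lra).
    pose proof (Rabs_pos k). nra.
  - intros x z Hxz. destruct (Hmvt (Y x) (Y z)) as [t [_ Ht]]. rewrite !HY in Ht.
    specialize (Hb t). nra.
  - intros y. exists (Z y). destruct (Hmvt (Y (Z y)) y) as [t [_ Ht]].
    rewrite HY in Ht. lra.
Qed.

(** The coordinate [u = logistic y] sends the equilibria [0] and [1] to infinity.
    Since the decay rate of the wave vanishes linearly at both, the equation for [y]
    has a bounded right-hand side, and its solutions are global. *)
Definition logistic (y : R) : R := / (1 + exp y).

Lemma logistic_bounds y : 0 < logistic y < 1.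
Proof.
  unfold logistic. pose proof (exp_pos y). split.
  - apply Rinv_0_lt_compat. lra.
  - rewrite <- Rinv_1. apply Rinv_lt_contravar; lra.
Qed.

Lemma logistic_derive y : is_derive logistic y (- (logistic y * (1 - logistic y))).
Proof.
  unfold logistic. pose proof (exp_pos y). auto_derive; [lra|]. field. lra.
Qed.

Lemma logistic_decreasing x y : x <= y -> logistic y <= logistic x.
Proof.
  intros Hxy. unfold logistic. pose proof (exp_pos x).
  apply Rinv_le_contravar; [lra|].
  destruct Hxy as [Hlt| ->]; [|lra]. pose proof (exp_increasing x y Hlt). lra.
Qed.

Lemma logistic_onto u : 0 < u < 1 -> exists y, logistic y = u.
Proof.
  intros Hu. exists (ln ((1 - u) / u)). unfold logistic.
  rewrite exp_ln by (apply Rdiv_lt_0_compat; lra). field. lra.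
Qed.

Lemma decreasing_onto_limits (u : R -> R) :
  (forall x z, x <= z -> u z <= u x) -> (forall z, 0 < u z < 1) ->
  (forall v, 0 < v < 1 -> exists z, u z = v) ->
  is_lim u m_infty 1 /\ is_lim u p_infty 0.
Proof.
  intros Hmon Hb Honto. split; apply is_lim_spec; intros eps; simpl;
    pose proof (cond_pos eps) as He; set (e := Rmin (eps / 2) (/ 2));
    assert (He1 : e <= eps / 2) by apply Rmin_l;
    assert (He2 : e <= / 2) by apply Rmin_r;
    assert (He0 : 0 < e) by (apply Rmin_pos; lra).
  - destruct (Honto (1 - e)) as [z Hz]; [lra|].
    exists z. intros x Hx. specialize (Hmon x z ltac:(lra)). specialize (Hb x).
    apply Rabs_lt_between. lra.
  - destruct (Honto e) as [z Hz]; [lra|].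
    exists z. intros x Hx. specialize (Hmon z x ltac:(lra)). specialize (Hb x).
    apply Rabs_lt_between. lra.
Qed.

Lemma pde_of_profile (Df F : R -> R) (c : R) (u : R -> R) :
  classical_ode_solution Df F c u -> solves_pde Df F (fun x t => u (x - c * t)).
Proof.
  intros (Hu & Hq & Hode) x t _.
  assert (Hut : is_derive (fun s => u (x - c * s)) t (- c * Derive u (x - c * t))).
  { evar_last.
    - apply (is_derive_comp u (fun s => x - c * s)).
      + apply Derive_correct, Hu.
      + auto_derive; [exact I|reflexivity].
    - unfold scal; simpl; unfold mult; simpl. ring. }
  assert (Hshift : forall f y, ex_derive f (y - c * t) ->
    is_derive (fun w => f (w - c * t)) y (Derive f (y - c * t))).
  { intros f y Hf. evar_last.
    - apply (is_derive_comp f (fun w => w - c * t)).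
      + apply Derive_correct, Hf.
      + auto_derive; [exact I|reflexivity].
    - unfold scal; simpl; unfold mult; simpl. ring. }
  assert (Hfl : is_derive (fun y => Df (u (y - c * t)) * Derive (fun w => u (w - c * t)) y) x
    (Derive (flux Df u) (x - c * t))).
  { apply (is_derive_ext (fun y => flux Df u (y - c * t))).
    - intros y. unfold flux. f_equal. symmetry. apply is_derive_unique, Hshift, Hu.
    - apply Hshift, Hq. }
  split; [eexists; exact Hut|].
  split; [eexists; apply Hshift, Hu|].
  split; [eexists; exact Hfl|].
  apply is_derive_unique in Hut. apply is_derive_unique in Hfl.
  transitivity (Derive (flux Df u) (x - c * t) + F (u (x - c * t))).
  - rewrite (Hut : Derive (fun s : R => u (x - c * s)) t = _).
    specialize (Hode (x - c * t)). lra.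
  - f_equal. symmetry. exact Hfl.
Qed.

Lemma C1_of_is_derive (f g : R -> R) :
  (forall z, is_derive f z (g z)) -> (forall z, continuous g z) -> Defs.C1 f.
Proof.
  intros Hf Hg z. split; [exists (g z); apply Hf|].
  apply (continuous_ext g); [|apply Hg].
  intros y. symmetry. apply is_derive_unique, Hf.
Qed.

(** In the phase plane the wave satisfies [u' = - w u] with
    [w = lambda * u * (1 - u) * H u].  Its flux is [- (Df * w) u], and the chain rule
    turns the derivative [c - / H] of [Df * w] into the equation of the wave. *)
Lemma wave_of_orbit (Df : R -> R) (lambda c C : R) (H : R -> R) :
  0 < lambda -> 0 < c ->
  (forall u, 0 < u < 1 ->
    continuous H u /\ 0 < H u <= C /\
    is_derive (fun u => Df u * (lambda * u * (1 - u) * H u)) u (c - / H u)) ->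
  exists u, smooth_travelling_wave Df (reaction lambda) c u /\
    monotone u /\ nonnegative u.
Proof.
  intros Hl Hc HH.
  destruct (autonomous_solution (fun y => lambda * H (logistic y)) (lambda * C))
    as (Y & HY & Ymon & Yonto).
  { intros y. apply (continuous_mult (K := R_AbsRing)); [apply continuous_const|].
    apply (continuous_comp logistic H); [|apply HH, logistic_bounds].
    apply differentiable_continuous. eexists; apply logistic_derive. }
  { intros y. destruct (HH _ (logistic_bounds y)) as (_ & H1 & _).
    split; [nra|]. apply Rmult_le_compat_l; lra. }
  set (u := fun z => logistic (Y z)).
  assert (Hub : forall z, 0 < u z < 1) by (intros z; apply logistic_bounds).
  set (w := fun v => lambda * v * (1 - v) * H v).
  assert (Hu : forall z, is_derive u z (- w (u z))).
  { intros z. evar_last.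
    - apply (is_derive_comp logistic Y); [apply logistic_derive|apply HY].
    - change (lambda * H (u z) * - (u z * (1 - u z)) = - w (u z)). unfold w. ring. }
  assert (Huc : forall z, continuous u z).
  { intros z. apply differentiable_continuous. eexists; apply Hu. }
  assert (Hwc : forall z, continuous (fun z => w (u z)) z).
  { intros z. apply (continuous_comp u w); [apply Huc|].
    apply (continuous_mult (K := R_AbsRing)); [|apply HH, Hub].
    apply differentiable_continuous. auto_derive. exact I. }
  assert (Hmon : forall x z, x <= z -> u z <= u x).
  { intros x z Hxz. apply logistic_decreasing, Ymon, Hxz. }
  assert (Hfl : forall z, is_derive (flux Df u) z (c * w (u z) - reaction lambda (u z))).
  { intros z. apply (is_derive_ext (fun z => - (Df (u z) * w (u z)))).
    - intros y. unfold flux. rewrite (is_derive_unique _ _ _ (Hu y)).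
      exact (Ropp_mult_distr_r (Df (u y)) (w (u y))).
    - destruct (HH _ (Hub z)) as (_ & H1 & H2).
      evar_last.
      + apply (is_derive_opp (V := R_NormedModule)).
        apply (is_derive_comp (fun v => Df v * w v) u); [exact H2|apply Hu].
      + change (- (- w (u z) * (c - / H (u z))) = c * w (u z) - reaction lambda (u z)).
        unfold w, reaction. field. lra. }
  assert (Hode : classical_ode_solution Df (reaction lambda) c u).
  { split; [|split].
    - apply C1_of_is_derive with (g := fun z => - w (u z)); [exact Hu|].
      intros z. apply (continuous_opp (V := R_NormedModule)), Hwc.
    - apply C1_of_is_derive with (1 := Hfl). intros z.
      apply (continuous_minus (V := R_NormedModule)).
      + apply (continuous_mult (K := R_AbsRing)); [apply continuous_const|apply Hwc].
      + apply (continuous_comp u (reaction lambda)); [apply Huc|].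
        apply differentiable_continuous. unfold reaction. auto_derive. exact I.
    - intros z. rewrite (is_derive_unique _ _ _ (Hfl z)), (is_derive_unique _ _ _ (Hu z)).
      ring. }
  assert (Hlim : is_lim u m_infty 1 /\ is_lim u p_infty 0).
  { apply decreasing_onto_limits; try assumption.
    intros v Hv. destruct (logistic_onto v Hv) as [y Hy].
    destruct (Yonto y) as [z Hz]. exists z. unfold u. rewrite Hz. exact Hy. }
  exists u. split; [|split].
  - split; [exact Hc|]. split; [now apply pde_of_profile|]. split; [exact Hode|exact Hlim].
  - right. exact Hmon.
  - intros z. specialize (Hub z). lra.
Qed.

Theorem theorem1 (lambda Dg Di : R) (hlambda : 0 < lambda) (hDg : 0 < Dg)
    (hDi : 4 * Dg < Di) (c : R) (hc : 2 * sqrt (lambda * Di) <= c) :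
  exists u : R -> R,
    smooth_travelling_wave (diffusivity Di Dg) (reaction lambda) c u /\
    monotone u /\ nonnegative u.
Proof.
  assert (HlD : 0 < lambda * Di) by (apply Rmult_lt_0_compat; lra).
  assert (Hs : 0 < sqrt (lambda * Di)) by now apply sqrt_lt_R0.
  assert (HM : lambda * Di <= (c / 2) ^ 2).
  { rewrite <- (pow2_sqrt (lambda * Di)) by lra. apply pow_incr. lra. }
  set (E := Di - Dg). assert (HE : 0 < E) by (unfold E; lra).
  (* The zeros of the diffusivity are [2 / 3 - sg] and [2 / 3 + sg]. *)
  set (sg := sqrt ((Di - 4 * Dg) / (9 * E))).
  assert (Hsg2 : 9 * E * sg ^ 2 = Di - 4 * Dg).
  { unfold sg. rewrite pow2_sqrt; [field; lra|]. apply Rdiv_le_0_compat; lra. }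
  assert (Hsg0 : 0 < sg) by (apply sqrt_lt_R0, Rdiv_lt_0_compat; lra).
  assert (Hsg1 : sg < / 3).
  { assert (9 * sg ^ 2 < 1).
    { apply Rmult_lt_reg_l with E; [lra|]. unfold E in *. lra. }
    nra. }
  assert (HlE : 0 < lambda * E) by now apply Rmult_lt_0_compat.
  assert (HlED : lambda * E < lambda * Di) by (apply Rmult_lt_compat_l; unfold E; lra).
  destruct (heteroclinic_orbit (3 * E * lambda) (2 / 3 - sg) (2 / 3 + sg) (c / 2))
    as (H & C & HH); try lra.
  - replace (3 * E * lambda * (2 / 3 - sg) * (2 / 3 + sg))
      with (lambda * (4 / 3 * E - / 3 * (9 * E * sg ^ 2))) by field.
    rewrite Hsg2. replace (4 / 3 * E - / 3 * (Di - 4 * Dg)) with Di by (unfold E; field).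
    exact HM.
  - nra.
  - assert ((1 - (2 / 3 + sg)) * (1 - (2 / 3 - sg)) <= / 3 * (2 / 3)) by nra. nra.
  - apply wave_of_orbit with (C := C) (H := H); [lra|lra|].
    intros u Hu. destruct (HH u Hu) as (H1 & H2 & H3). split; [exact H1|split; [exact H2|]].
    replace (c - / H u) with (2 * (c / 2) - / H u) by lra.
    eapply is_derive_ext; [|exact H3]. intros t.
    assert (HD : diffusivity Di Dg t = 3 * E * (t - (2 / 3 - sg)) * (t - (2 / 3 + sg))).
    { unfold diffusivity.
      replace (3 * E * (t - (2 / 3 - sg)) * (t - (2 / 3 + sg)))
        with (3 * E * (t - 2 / 3) ^ 2 - / 3 * (9 * E * sg ^ 2)) by field.
      rewrite Hsg2. unfold E. field. }
    rewrite HD. match goal with |- ?a = ?b => change (@eq R a b) end. ring.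
Qed.
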